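(* Let $k$ be a field. For $1\le i\le t$ let $M_i=U(n_i-1,n_i)$ with $n_i\ge 2$. Assume $E(M_i)\cap E(M_{i+1})=\{p_{i+1}\}$ for $1\le i\le t-1$, $E(M_i)\cap E(M_j)=\emptyset$ for $|i-j|\ge2$, and $p_i\neq p_j$ for $i\neq j$. Then the parallel connection $M=P(M_1,\ldots,M_t;p_2,\ldots,p_t)$ has an NBC basis.
   Context: $U(r,n)$ is the uniform matroid on an $n$-element set whose bases are all $r$-element subsets. For matroids $M,N$ with $p\in E(M)\cap E(N)$, $P(M,N;p)$ is the matroid on $E(M)\cup E(N)$ with circuits $\mathcal{C}(M)\cup\mathcal{C}(N)\cup\{(C_1\cup C_2)\setminus\{p\}: C_1\in\mathcal{C}(M), C_2\in\mathcal{C}(N), p\in C_1\cap C_2\}$. $P(M_1,\ldots,M_t;p_2,\ldots,p_t)=P_t$ where $P_1=M_1$ and $P_i=P(P_{i-1},M_i;p_i)$ for $2\le i\le t$. NBC basis: for a regular matroid $N$ of rank $s$ with ground set ordered $e_1<\cdots<e_m$ such that $B=\{e_{m-s+1},\ldots,e_m\}$ is a basis, let $\mathrm{ci}(B,e)$ ($e\notin B$) be the unique circuit in $B\cup\{e\}$ and $\mathrm{coc}(B,b)$ ($b\in B$) the unique cocircuit in $(E\setminus B)\cup\{b\}$ containing $b$. With an admissible signed fundamental cocircuit incidence matrix $(a^*_{ji})$ (a $\pm1$-signing of the $0/1$ incidence matrix of the cocircuits $\mathrm{coc}(B,e_j)$, restricted from a signing of the full cocircuit incidence matrix that is orthogonal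 over $k$ to some signing of the full circuit incidence matrix), put $\Theta^B=\{\sum_{e_i\in\mathrm{coc}(B,e_j)}a^*_{ji}x_i: e_j\in B\}$ and $k(\Delta_{\mathrm{BC}}(N))=k[x_1,\ldots,x_m]/(\langle\prod_{e_i\in\overline{C}}x_i : C\text{ circuit}\rangle+(\Theta^B))$, where $\overline{C}=C\setminus\{\min C\}$. Label circuits with $C_i=\mathrm{ci}(B,e_i)$ for $i\le m-s$; let $d_j=j$ for $j\le m-s$, $d_j=\min\{i: e_i\in\mathrm{coc}(B,e_j)\}$ for $j>m-s$; $m_{C_i}=x_i^{|\overline{C}_i|}$ for $i\le m-s$ and $m_{C_i}=\prod_{e_j\in\overline{C}_i}x_{d_j}$ otherwise; $L(N)$ = monomials in $x_1,\ldots,x_{m-s}$ divisible by no $m_C$. $N$ has an NBC basis if for some such ordering the images of $L(N)$ form a $k$-basis of $k(\Delta_{\mathrm{BC}}(N))$. *)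

(* Defs.v *)
From mathcomp Require Import all_boot all_algebra.
From mathcomp Require Import mpoly.
Set Implicit Arguments. Unset Strict Implicit. Unset Printing Implicit Defensive.
Import GRing.Theory.
Local Open Scope ring_scope.

Section Matroids.
Variable T : finType.

Record matroid := Matroid { ground : {set T}; circuits : {set {set T}} }.

Definition indep (N : matroid) (A : {set T}) : bool :=
  (A \subset ground N) && [forall C in circuits N, ~~ (C \subset A)].

Definition is_basis (N : matroid) (B : {set T}) : bool :=
  indep N B && [forall A : {set T}, (indep N A && (B \subset A)) ==> (A == B)].

Definition mrank (N : matroid) : nat := \max_(A : {set T} | indep N A) #|A|.

Definition meets_all_bases (N : matroid) (D : {set T}) : bool :=
  (D != set0) && (D \subset ground N) &&
  [forall B : {set T}, is_basis N B ==> (D :&: B != set0)].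

Definition cocircuits (N : matroid) : {set {set T}} :=
  [set D : {set T} | meets_all_bases N D &&
     [forall D' : {set T}, (D' \proper D) ==> ~~ meets_all_bases N D']].

Definition matroid_of_bases (S : {set T}) (Bs : {set {set T}}) : matroid :=
  let dep := fun X : {set T} => (X \subset S) && ~~ [exists B in Bs, X \subset B] in
  Matroid S [set C : {set T} | dep C && [forall C' : {set T}, (C' \proper C) ==> ~~ dep C']].

(* U(r,n) on the n-element set S (n = #|S|): bases are all r-subsets of S *)
Definition uniform (r : nat) (S : {set T}) : matroid :=
  matroid_of_bases S [set X : {set T} | (X \subset S) && (#|X| == r)].

Definition parallel_connection (M N : matroid) (p : T) : matroid :=
  Matroid (ground M :|: ground N)
    (circuits M :|: circuits N :|:
     [set (C1 :|: C2) :\ p | C1 in circuits M, C2 in circuits N &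
                              (p \in C1) && (p \in C2)]).

(* P(M_0,...,M_i; p_1,...,p_i)  (0-based indices) *)
Fixpoint parallel_iter (M : nat -> matroid) (p : nat -> T) (i : nat) : matroid :=
  match i with
  | 0 => M 0
  | i'.+1 => parallel_connection (parallel_iter M p i') (M i'.+1) (p i'.+1)
  end.

(* NBC bases.  Indices are 0-based: the ordering e_0 < ... < e_{m-1}. *)
Section NBC.
Variable k : fieldType.
Variable N : matroid.
Local Notation m := #|ground N|.
Local Notation s := (mrank N).

Definition ci (B : {set T}) (x : T) : {set T} :=
  odflt set0 [pick C in circuits N | C \subset x |: B].

Definition coc (B : {set T}) (b : T) : {set T} :=
  odflt set0 [pick D in cocircuits N | (b \in D) && (D \subset b |: (ground N :\: B))].

Variable e : 'I_m -> T.

(* index set of \bar C = C \ {min C} *)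
Definition Cbar (C : {set T}) : {set 'I_m} :=
  [set j : 'I_m | (e j \in C) && [exists i : 'I_m, (i < j)%N && (e i \in C)]].

Definition min_index (D : {set T}) (j : 'I_m) : 'I_m :=
  odflt j [pick i : 'I_m | (e i \in D) && [forall i' : 'I_m, (i' < i)%N ==> (e i' \notin D)]].

Definition Bset : {set T} := [set e i | i : 'I_m & (m - s <= i)%N].

Definition dj (j : 'I_m) : 'I_m :=
  if (j < m - s)%N then j else min_index (coc Bset (e j)) j.

Definition mC (C : {set T}) : 'X_{1..m} :=
  match [pick i : 'I_m | (i < m - s)%N && (C == ci Bset (e i))] with
  | Some i0 => [multinom (if i == i0 then #|Cbar C| else 0%N) | i < m]
  | None => [multinom #|[set j in Cbar C | dj j == i]| | i < m]
  end.

Definition mdivides (a b : 'X_{1..m}) : bool := [forall i, (a i <= b i)%N].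

Definition inL (mo : 'X_{1..m}) : bool :=
  [forall i : 'I_m, (m - s <= i)%N ==> (mo i == 0%N)] &&
  [forall C in circuits N, ~~ mdivides (mC C) mo].

Definition signing (Xs : {set {set T}}) (f : {set T} -> T -> k) : Prop :=
  forall X x, X \in Xs ->
    (x \in X -> f X x = 1 \/ f X x = -1) /\ (x \notin X -> f X x = 0).

Definition admissible (fstar : {set T} -> T -> k) : Prop :=
  signing (cocircuits N) fstar /\
  exists f, signing (circuits N) f /\
    forall C D, C \in circuits N -> D \in cocircuits N ->
      \sum_(x : T) f C x * fstar D x = 0.

Variable astar : {set T} -> T -> k.

Definition theta (j : 'I_m) : {mpoly k[m]} :=
  \sum_(i : 'I_m | e i \in coc Bset (e j)) astar (coc Bset (e j)) (e i) *: 'X_i.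

Definition BC_gens : seq {mpoly k[m]} :=
  [seq \prod_(j in Cbar C) 'X_j | C <- enum (circuits N)] ++
  map theta (filter (fun j0 : 'I_m => (m - s <= j0)%N) (enum 'I_m)).

Definition in_ideal (gs : seq {mpoly k[m]}) (p : {mpoly k[m]}) : Prop :=
  exists c : seq {mpoly k[m]}, p = \sum_(i < size gs) c`_i * gs`_i.

Definition supported_on_L (q : {mpoly k[m]}) : Prop :=
  forall mo, mo \in msupp q -> inL mo.

(* images of L(N) form a k-basis of k[x]/(I_BC + (Theta^B)) *)
Definition L_is_basis : Prop :=
  (forall p : {mpoly k[m]}, exists q, supported_on_L q /\ in_ideal BC_gens (p - q)) /\
  (forall q : {mpoly k[m]}, supported_on_L q -> in_ideal BC_gens q -> q = 0).

End NBC.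

Definition has_NBC_basis (k : fieldType) (N : matroid) : Prop :=
  exists e : 'I_#|ground N| -> T,
    injective e /\ (forall i, e i \in ground N) /\
    is_basis N (@Bset N e) /\
    exists astar : {set T} -> T -> k, @admissible k N astar /\ @L_is_basis k N e astar.

End Matroids.

(* Main.v *)
Require Import Defs.
From mathcomp Require Import all_boot all_algebra.
From mathcomp Require Import mpoly zify ring.

(**
  The matroid is graphic and planar, and it is easiest to see through its dual
  graph: the cycles [E 0, ..., E r] are vertices [0, ..., r], the outer face is
  a vertex [r.+1], and every element is an edge. The circuits are the cuts of
  the intervals [[i, j]] of [0 .. r], the cocircuits are the cycles of the dual
  graph. Take as non-basis elements the spanning path [q_0, ..., q_r] of the
  dual graph, where [q_l] joins [l] to [l.+1], ordered [q_0 < ... < q_r] before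
  the rest. Write [y_l] for the variable of [q_l], [s_l] for
  [y_l + ... + y_r] and [a_l] for the number of basis elements whose first face
  is [l]. The linear forms identify the variable of such an element with [s_l],
  and the broken circuits then generate the ideal
  [(s_0 ^ a_0, y_1 s_1 ^ a_1, ..., y_r s_r ^ a_r)]. The [l]-th generator is
  monic in [y_l], of degree [a_0] if [l = 0] and [a_l + 1] otherwise, over the
  polynomials in [y_(l+1), ..., y_r], so the quotient is a tower of free
  extensions whose basis is the box of monomials below these degrees; this box
  is exactly [L(N)].
*)

Set Implicit Arguments. Unset Strict Implicit. Unset Printing Implicit Defensive.
Import GRing.Theory.
Local Open Scope ring_scope.

(** * Triangular systems of polynomials *)

(* The ring [A] is an iterated polynomial ring, [z i] its variables. The
   functional [L] reads off the coefficient at [ex] of the normal form obtained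
   by successive division by the monic generators; hence it kills the ideal
   they generate. *)
Lemma triangular_functionals (k : comNzRingType) (n : nat) (dl a : nat -> nat) :
  exists (A : comNzRingType) (iota : {rmorphism k -> A}) (z : nat -> A),
  forall ex : nat -> nat, (forall i, (i < n)%N -> (ex i < dl i + a i)%N) ->
  exists L : A -> k,
  [/\ forall x y, L (x + y) = L x + L y,
      forall c x, L (iota c * x) = c * L x,
      forall i x, (i < n)%N ->
        L (z i ^+ dl i * (\sum_(i <= l < n) z l) ^+ a i * x) = 0
    & forall ex' : nat -> nat, (forall i, (i < n)%N -> (ex' i < dl i + a i)%N) ->
        L (\prod_(i < n) z i ^+ ex' i) = [forall i : 'I_n, ex' i == ex i]%:R].
Proof.
elim: n dl a => [|n IHn] dl a.
  exists k, idfun, (fun=> 0) => ex _; exists id; split => // ex' _.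
  rewrite big_ord0; case: forallP => // [[]]; by case.
have [A [iota [z Hz]]] := IHn (fun i => dl i.+1) (fun i => a i.+1).
(* The new variable takes index 0 and the old ones become constants of [{poly A}], so the [i]-th
   generator involves only variables of index at least [i]. *)
pose z1 i : {poly A} := if i is i'.+1 then (z i')%:P else 'X.
exists ({poly A} : comNzRingType), (polyC \o iota), z1 => ex Hex.
have [i ltin|L [LD LZ LG LE]] := Hz (fun i => ex i.+1); first exact: (Hex i.+1).
have sumz1 i : \sum_(i.+1 <= l < n.+1) z1 l = (\sum_(i <= l < n) z l)%:P.
  by rewrite big_add1 /= rmorph_sum.
pose g : {poly A} := 'X ^+ dl 0%N * ('X + (\sum_(0 <= l < n) z l)%:P) ^+ a 0%N.
have g_monic : g \is monic.
  by rewrite monicMl ?monicXn // monic_exp // monicXaddC.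
have size_g : size g = (dl 0%N + a 0%N).+1.
  rewrite /g size_monicM ?monicXn ?monic_neq0 ?monic_exp ?monicXaddC //.
  rewrite size_polyXn -[X in 'X + X]opprK -polyCN size_exp_XsubC //.
  by rewrite addSn addnS.
(* Divide by the monic [g], take the coefficient of ['X ^+ ex 0], and apply the functional of the
   smaller system to it. *)
exists (fun P => L ((Pdiv.Ring.rmodp P g)`_(ex 0%N))); split.
- by move=> x y; rewrite Pdiv.RingMonic.rmodpD // coefD LD.
- by move=> c x /=; rewrite mul_polyC Pdiv.RingMonic.rmodpZ // coefZ LZ.
- have L0 : L 0 = 0 by rewrite -[0](mul0r 0) -(rmorph0 iota) LZ mul0r.
  case=> [|i] x ltin /=.
    by rewrite big_ltn // sumz1 -/g mulrC Pdiv.RingMonic.rmodp_mull // coef0.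
  (* A generator of positive index is a constant of [{poly A}]: it factors out of the remainder, and
     [L] kills the resulting coefficient. *)
  rewrite sumz1 -!rmorphXn -rmorphM /= mul_polyC Pdiv.RingMonic.rmodpZ //.
  by rewrite coefZ LG.
move=> ex' Hex'; rewrite big_ord_recl /=.
under eq_bigr => i _ do rewrite /z1 /= -rmorphXn.
rewrite -rmorph_prod /= mulrC mul_polyC Pdiv.RingMonic.rmodpZ // coefZ.
(* The degree [ex' 0] is below that of [g], so this power of ['X] is its own remainder. *)
rewrite Pdiv.Ring.rmodp_small; last by rewrite size_polyXn size_g ltnS Hex'.
rewrite coefXn; have [eq0|ne0] := eqVneq (ex 0%N) (ex' 0%N); last first.
  rewrite mulr0 -[0](mul0r 0) -(rmorph0 iota) LZ mul0r.
  case: forallP => // H; move: (H ord0); by rewrite eq_sym (negbTE ne0).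
rewrite mulr1 /bump /= (LE (fun i => ex' i.+1)) => [|i ltin]; last exact: (Hex' i.+1).
congr (nat_of_bool _)%:R; apply/forallP/forallP => H i.
  have [-> |[j ->]] : i = ord0 \/ exists j, i = lift ord0 j.
  - by case: (unliftP ord0 i) => [j|] ->; [right; exists j | left].
  - by rewrite eq0.
  exact: H.
exact: (H (lift ord0 i)).
Qed.

(** * Membership in a finitely generated ideal *)

Section Ideals.
Variables (T : finType) (N : matroid T) (k : fieldType).
Local Notation m := #|ground N|.
Variable gs : seq {mpoly k[m]}.
Local Notation in_ideal := (@in_ideal T k N).

Lemma in_ideal_mem g : g \in gs -> in_ideal gs g.
Proof.
move=> gs_g; exists (mkseq (fun i => (i == index g gs)%:R) (size gs)).
have lt_ig : (index g gs < size gs)%N by rewrite index_mem.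
rewrite (bigD1 (Ordinal lt_ig)) //= nth_mkseq // eqxx mul1r nth_index //.
rewrite big1 ?addr0 // => i ne_i; rewrite nth_mkseq //.
by case: eqP => [eq_i|]; rewrite ?mul0r //; case/eqP: ne_i; apply: val_inj.
Qed.

Lemma in_idealD p q : in_ideal gs p -> in_ideal gs q -> in_ideal gs (p + q).
Proof.
move=> [c ->] [d ->]; exists (mkseq (fun i => c`_i + d`_i) (size gs)).
by rewrite -big_split; apply: eq_bigr => i _ /=; rewrite nth_mkseq // mulrDl.
Qed.

Lemma in_idealMl r p : in_ideal gs p -> in_ideal gs (r * p).
Proof.
move=> [c ->]; exists (mkseq (fun i => r * c`_i) (size gs)).
by rewrite mulr_sumr; apply: eq_bigr => i _ /=; rewrite nth_mkseq // mulrA.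
Qed.

Lemma in_ideal0 : in_ideal gs 0.
Proof. by exists [::]; rewrite big1 // => i _; rewrite nth_nil mul0r. Qed.

Lemma in_idealN p : in_ideal gs p -> in_ideal gs (- p).
Proof. by rewrite -mulN1r; apply: in_idealMl. Qed.

Lemma in_ideal_prodB (I : Type) (r : seq I) (P : pred I) (F G : I -> {mpoly k[m]}) :
  (forall i, P i -> in_ideal gs (F i - G i)) ->
  in_ideal gs (\prod_(i <- r | P i) F i - \prod_(i <- r | P i) G i).
Proof.
move=> FG; apply: (big_ind2 (fun x y => in_ideal gs (x - y))) => //.
  by rewrite subrr; apply: in_ideal0.
move=> x1 x2 y1 y2 Hx Hy.
have -> : x1 * y1 - x2 * y2 = y1 * (x1 - x2) + x2 * (y1 - y2).
  by rewrite !mulrBr ![y1 * _]mulrC addrA subrK.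
by apply: in_idealD; apply: in_idealMl.
Qed.

Lemma ideal_killed (L : {mpoly k[m]} -> k) p :
  (forall x y, L (x + y) = L x + L y) ->
  (forall g r, g \in gs -> L (r * g) = 0) -> in_ideal gs p -> L p = 0.
Proof.
move=> LD Lg [c ->]; apply: (big_ind (fun x => L x = 0)).
- by apply: (addIr (L 0)); rewrite -LD !add0r.
- by move=> x y Lx Ly; rewrite LD Lx Ly addr0.
by move=> i _; apply/Lg/mem_nth.
Qed.

(** * Reduction of polynomials to a box of monomials *)

Section Spanning.
Variables (w d : 'I_m -> nat) (G : 'I_m -> {mpoly k[m]}).

Definition weight (mo : 'X_{1..m}) := (\sum_i w i * mo i)%N.
Definition weight_lt (W : nat) (q : {mpoly k[m]}) :=
  forall mo, mo \in msupp q -> (weight mo < W)%N.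

Lemma weightD mo1 mo2 : weight (mo1 + mo2)%MM = (weight mo1 + weight mo2)%N.
Proof.
by rewrite /weight -big_split; apply: eq_bigr => i _; rewrite mnmDE mulnDr.
Qed.

Lemma weight1 i : weight U_(i) = w i.
Proof.
rewrite /weight (bigD1 i) //= mnm1E eqxx muln1 big1 ?addn0 // => j ne_ji.
by rewrite mnm1E eq_sym (negbTE ne_ji) muln0.
Qed.

Lemma weightMn mo n : weight (mo *+ n)%MM = (weight mo * n)%N.
Proof.
by rewrite /weight big_distrl; apply: eq_bigr => i _; rewrite mulmnE mulnA.
Qed.

Lemma weight_ltD W p q : weight_lt W p -> weight_lt W q -> weight_lt W (p + q).
Proof.
by move=> Hp Hq mo /msuppD_le; rewrite mem_cat => /orP[/Hp|/Hq].
Qed.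

Lemma weight_lt_le V W p : (V <= W)%N -> weight_lt V p -> weight_lt W p.
Proof. by move=> VW Hp mo /Hp /leq_trans; apply. Qed.

Lemma weight_ltM V W p q :
  weight_lt V.+1 p -> weight_lt W q -> weight_lt (V + W) (p * q).
Proof.
move=> Hp Hq mo /msuppM_le /allpairsP[[m1 m2] /= [/Hp H1 /Hq H2 ->]].
by rewrite weightD -addnS leq_add.
Qed.

Lemma weight_ltX mo : weight_lt (weight mo).+1 'X_[mo].
Proof. by move=> mo'; rewrite msuppX inE => /eqP ->. Qed.

(** Every term of the expansion other than [p ^+ n] contains a factor [s], whose weight is strictly
    smaller. The second bound is carried along for the induction. *)
Lemma weight_lt_prodB V n p s :
  weight_lt V.+1 p -> weight_lt V s ->
  weight_lt (V * n) ((p + s) ^+ n - p ^+ n) /\ weight_lt (V * n).+1 ((p + s) ^+ n).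
Proof.
move=> Hp Hs; have Hps : weight_lt V.+1 (p + s).
  by apply: weight_ltD => //; apply: weight_lt_le Hs.
elim: n => [|n [IH1 IH2]].
  rewrite !expr0 subrr muln0; split; first by move=> mo; rewrite msupp0.
  by move=> mo; rewrite msupp1 inE => /eqP ->; rewrite /weight big1 // => i _; rewrite mnm0E muln0.
split; last by rewrite exprS mulnS -addnS; apply: weight_ltM.
have -> : (p + s) ^+ n.+1 - p ^+ n.+1 =
          p * ((p + s) ^+ n - p ^+ n) + (p + s) ^+ n * s.
  by rewrite !exprS mulrBr mulrDl [s * _]mulrC addrAC.
apply: weight_ltD; first by rewrite mulnS; apply: weight_ltM.
by rewrite mulnS addnC; apply: weight_ltM.
Qed.

Hypothesis G_ideal : forall i, in_ideal gs (G i).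
Hypothesis G_lead : forall i, weight_lt (w i * d i) (G i - 'X_i ^+ d i).

(** For the weight, [G i] has leading term ['X_i ^+ d i]. A monomial outside the box is divisible by
    one of these, so modulo the ideal it equals a combination of monomials of strictly smaller
    weight; induct on the weight. *)
Lemma box_spanning p :
  exists q, (forall mo, mo \in msupp q -> [forall i, mo i < d i]%N)
            /\ in_ideal gs (p - q).
Proof.
pose box (mo : 'X_{1..m}) := [forall i, mo i < d i]%N.
pose Sp p := exists q, (forall mo, mo \in msupp q -> box mo) /\ in_ideal gs (p - q).
have Sp0 : Sp 0.
  by exists 0; split; [move=> mo; rewrite msupp0 | rewrite subrr; apply: in_ideal0].
have SpD x y : Sp x -> Sp y -> Sp (x + y).
  move=> [u [Hu Iu]] [v [Hv Iv]]; exists (u + v); split.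
    by move=> mo /msuppD_le; rewrite mem_cat => /orP[/Hu|/Hv].
  by rewrite opprD addrACA; apply: in_idealD.
have SpZ c x : Sp x -> Sp (c *: x).
  move=> [u [Hu Iu]]; exists (c *: u); split; first by move=> mo /msuppZ_le /Hu.
  by rewrite -scalerBr -mul_mpolyC; apply: in_idealMl.
have SpI x y : in_ideal gs (x - y) -> Sp y -> Sp x.
  move=> Ixy [u [Hu Iu]]; exists u; split => //.
  by rewrite -(subrK y x) -addrA; apply: in_idealD.
have SpS q : (forall mo, mo \in msupp q -> Sp 'X_[mo]) -> Sp q.
  move=> H; rewrite [q]mpolyE big_seq.
  by apply: (big_ind Sp) => // mo /H; apply: SpZ.
suff SpX W mo : (weight mo < W)%N -> Sp 'X_[mo].
  by apply: SpS => mo _; apply: SpX (ltnSn _).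
elim: W mo => [//|W IH] mo; rewrite ltnS => le_mo.
have [bmo|/forallPn[i]] := boolP (box mo).
  exists 'X_[mo]; split; last by rewrite subrr; apply: in_ideal0.
  by move=> mo'; rewrite msuppX inE => /eqP ->.
rewrite -leqNgt => le_d.
have le_m : (U_(i) *+ d i <= mo)%MM.
  apply/mnm_lepP => j; rewrite mulmnE mnm1E.
  by case: eqP => [<-|]; rewrite ?mul1n ?mul0n.
have def_mo : mo = ((mo - U_(i) *+ d i) + U_(i) *+ d i)%MM by rewrite submK.
set nu := (mo - _)%MM in def_mo.
(* Subtracting this polynomial from ['X_[mo]] leaves ['X_[nu] * G i], which lies in the ideal. *)
apply: (SpI _ (- 'X_[nu] * (G i - 'X_i ^+ d i))).
  rewrite mulNr opprK mulrBr def_mo mpolyXD mpolyXn addrC subrK.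
  exact: in_idealMl.
apply: SpS => mo' Hmo'; apply: IH.
apply: leq_trans le_mo.
rewrite [in X in (_ <= X)%N]def_mo weightD weightMn weight1.
apply: weight_ltM _ Hmo' => //.
by move=> m2; rewrite (perm_mem (msuppN _)); apply: weight_ltX.
Qed.

End Spanning.
End Ideals.

(** * Matroids given by a dual graph containing a Hamiltonian path *)

Section DualGraph.
Variables (T : finType) (N : matroid T) (r : nat) (sg : T -> nat) (q : nat -> T).
Local Notation S := (ground N).

(* In the dual graph the element [x] joins the vertex [sg x] to [tau x]; the
   outer face is [r.+1], and [q l] is the edge from [l] to [l.+1]. *)
Definition tau (x : T) : nat := if x == q (sg x) then (sg x).+1 else r.+1.

Definition cut (i j : nat) : {set T} :=
  [set x in S | (i <= sg x <= j)%N (+) (i <= tau x <= j)%N].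

Definition private (x : T) : bool := (x \in S) && (tau x == r.+1).

(** For [b] and [c] at the outer vertex, this is the cycle that runs through both and closes up
    along the path between [sg b] and [sg c]. *)
Definition dual_cycle (b c : T) : {set T} :=
  [set x in S | if tau x == r.+1 then (x == b) (+) (x == c)
                else (sg b <= sg x)%N (+) (sg c <= sg x)%N].

Hypothesis sg_le : forall x, x \in S -> (sg x <= r)%N.
Hypothesis q_in : forall l, (l <= r)%N -> q l \in S.
Hypothesis sg_q : forall l, (l <= r)%N -> sg (q l) = l.
Hypothesis circuitsE : forall C,
  reflect (exists i j, (i <= j <= r)%N /\ C = cut i j) (C \in circuits N).

Lemma q_inj l l' : (l <= r)%N -> (l' <= r)%N -> q l = q l' -> l = l'.
Proof. by move=> hl hl' eq_q; rewrite -(sg_q hl) eq_q sg_q. Qed.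

Lemma tau_q l : (l <= r)%N -> tau (q l) = l.+1.
Proof. by move=> hl; rewrite /tau sg_q // eqxx. Qed.

Lemma innerE x : tau x != r.+1 -> x = q (sg x).
Proof. by rewrite /tau; case: (x =P q (sg x)) => // _; rewrite eqxx. Qed.

Lemma inner_lt x : x \in S -> tau x != r.+1 -> (sg x < r)%N.
Proof. by move=> xS nt; have := sg_le xS; move: (nt); rewrite /tau -innerE // eqxx; lia. Qed.

Lemma mem_cut i j x : (i <= j <= r)%N -> x \in S ->
  (x \in cut i j) = if x == q (sg x) then (sg x == j) || ((sg x).+1 == i)
                    else (i <= sg x <= j)%N.
Proof.
move=> hij xS; rewrite inE xS /= /tau; case: eqP => _; first by lia.
have -> : (i <= r.+1 <= j)%N = false by lia.
by rewrite addbF.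
Qed.

Lemma q_cut i j l : (i <= j <= r)%N -> (l <= r)%N ->
  (q l \in cut i j) = (l == j) || (l.+1 == i).
Proof. by move=> hij hl; rewrite mem_cut ?q_in // !sg_q // eqxx. Qed.

Lemma private_mem b : private b -> b \in S. Proof. by case/andP. Qed.

Lemma private_q : private (q r).
Proof. by rewrite /private q_in // tau_q ?eqxx. Qed.

Lemma mem_dual_cyclel b c : private b -> b != c -> b \in dual_cycle b c.
Proof. by move=> /andP[bS tb] /negbTE nbc; rewrite inE bS tb eqxx nbc. Qed.

Lemma dual_cycleC b c : dual_cycle b c = dual_cycle c b.
Proof. by apply/setP => x; rewrite !inE addbC [X in if _ then _ else X]addbC. Qed.

Lemma dual_cycle_private b c x :
  private x -> x \in dual_cycle b c -> x = b \/ x = c.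
Proof.
move=> /andP[xS tx]; rewrite inE xS tx /=.
by case: eqP => [->|_]; [left | case: eqP => // ->; right].
Qed.

(** * Signed cuts and cycles, and their orthogonality *)

Section Vectors.
Variable k : fieldType.

(** Orient each edge from [sg] to [tau]: this is the coboundary of the indicator function of the
    interval. *)
Definition cut_vec (i j : nat) (x : T) : k :=
  if x \in S then (i <= sg x <= j)%N%:R - (i <= tau x <= j)%N%:R else 0.

(** In the same orientation, this is the unit flow that leaves along [b] to the outer vertex,
    returns along [c], and follows the path from [sg c] to [sg b]. *)
Definition cycle_vec (b c x : T) : k :=
  if x \notin S then 0
  else if tau x == r.+1 then (x == b)%:R - (x == c)%:R
  else (sg c <= sg x)%N%:R - (sg b <= sg x)%N%:R.

Lemma boolr_sub (u v : bool) :
  (u (+) v -> (u%:R - v%:R = 1 :> k) \/ (u%:R - v%:R = -1 :> k)) /\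
  (~~ (u (+) v) -> u%:R - v%:R = 0 :> k).
Proof.
by case: u; case: v; rewrite /= ?subrr ?subr0 ?sub0r; split=> // _; [left | right].
Qed.

Lemma cut_vec_sign i j x :
  (x \in cut i j -> cut_vec i j x = 1 \/ cut_vec i j x = -1) /\
  (x \notin cut i j -> cut_vec i j x = 0).
Proof.
rewrite inE /cut_vec; case: (x \in S) => /=; last by split.
exact: boolr_sub.
Qed.

Lemma cycle_vec_sign b c x :
  (x \in dual_cycle b c -> cycle_vec b c x = 1 \/ cycle_vec b c x = -1) /\
  (x \notin dual_cycle b c -> cycle_vec b c x = 0).
Proof.
rewrite inE /cycle_vec; case: (x \in S) => /=; last by split.
case: (_ == _); first exact: boolr_sub.
by rewrite addbC; apply: boolr_sub.
Qed.

Lemma cycle_vecN b c x : cycle_vec c b x = - cycle_vec b c x.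
Proof.
by rewrite /cycle_vec; case: ifP; rewrite ?oppr0 //; case: ifP; rewrite opprB.
Qed.

Lemma sum_inner (F : nat -> k) :
  \sum_(x in S | tau x != r.+1) F (sg x) = \sum_(0 <= l < r) F l.
Proof.
rewrite big_mkord; pose h (l : 'I_r) := q l.
have h_inj : injective h.
  by move=> l l' eq_h; apply: val_inj; apply: (q_inj _ _ eq_h); exact: ltnW (ltn_ord _).
rewrite (eq_bigl (mem (h @: [set: 'I_r]))); last first.
  move=> x /=; apply/andP/imsetP => [[xS nt]|[l _ ->]].
    by exists (Ordinal (inner_lt xS nt)); [rewrite inE | exact: innerE].
  have hl := ltnW (ltn_ord l).
  by rewrite /h q_in // tau_q // eqSS; split=> //; rewrite neq_ltn ltn_ord.
rewrite big_imset /=; last by move=> ? ? _ _; apply: h_inj.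
by apply: eq_big => [l|l _]; rewrite ?inE // /h sg_q // ltnW.
Qed.

(** The sum telescopes along the path from [sg b] to [r]. What remains does not depend on [b], so
    comparing two choices of [b] gives the orthogonality of cuts and cycles. *)
Lemma cut_vec_tail i j b : (i <= j <= r)%N -> private b ->
  cut_vec i j b - \sum_(x in S | tau x != r.+1) cut_vec i j x * (sg b <= sg x)%N%:R
  = (i <= r <= j)%N%:R.
Proof.
move=> hij /andP[bS /eqP tb].
pose chi l : k := (i <= l <= j)%N%:R.
rewrite (eq_bigr (fun x => (chi (sg x) - chi (sg x).+1) * (sg b <= sg x)%N%:R)); last first.
  by move=> x /andP[xS /innerE ex]; rewrite /cut_vec xS /tau -ex eqxx.
rewrite (sum_inner (fun l => (chi l - chi l.+1) * (sg b <= l)%N%:R)).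
rewrite (@big_cat_nat _ _ _ (sg b)) ?sg_le //= big_nat_cond big1 ?add0r; last first.
  move=> l /andP[/andP[_ hl] _]; rewrite leqNgt hl mulr0 //.
rewrite big_nat_cond (eq_bigr (fun l => - (chi l.+1 - chi l))); last first.
  by move=> l /andP[/andP[-> _] _]; rewrite mulr1 opprB.
rewrite -big_nat_cond sumrN telescope_sumr ?sg_le // opprK.
rewrite /cut_vec bS tb (_ : (i <= r.+1 <= j)%N = false); last by lia.
by rewrite subr0 addrCA subrr addr0.
Qed.

Lemma cut_cycle_orthogonal i j b c : (i <= j <= r)%N -> private b -> private c ->
  \sum_x cut_vec i j x * cycle_vec b c x = 0.
Proof.
move=> hij pb pc.
have half d : private d ->
  \sum_(x in S | tau x == r.+1) cut_vec i j x * (x == d)%:R = cut_vec i j d.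
  move=> pd; rewrite (bigD1 d) //= eqxx mulr1 big1 ?addr0 // => x /andP[_ nx].
  by rewrite (negbTE nx) mulr0.
rewrite (bigID (mem S)) /= [X in _ + X]big1 ?addr0; last first.
  by move=> x xS; rewrite /cut_vec (negbTE xS) mul0r.
rewrite (bigID (fun x => tau x == r.+1)) /=.
have -> : \sum_(x in S | tau x == r.+1) cut_vec i j x * cycle_vec b c x
  = cut_vec i j b - cut_vec i j c.
  rewrite -(half b pb) -(half c pc) -sumrB; apply: eq_bigr => x /andP[xS tx].
  by rewrite /cycle_vec xS tx mulrBr.
have -> : \sum_(x in S | tau x != r.+1) cut_vec i j x * cycle_vec b c x
  = \sum_(x in S | tau x != r.+1) cut_vec i j x * (sg c <= sg x)%N%:R
   - \sum_(x in S | tau x != r.+1) cut_vec i j x * (sg b <= sg x)%N%:R.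
  rewrite -sumrB; apply: eq_bigr => x /andP[xS tx].
  by rewrite /cycle_vec xS (negbTE tx) mulrBr.
have := cut_vec_tail hij pb; rewrite -(cut_vec_tail hij pc) => /eqP.
rewrite subr_eq => /eqP ->; ring.
Qed.
End Vectors.

(** A single common element would leave one nonzero term in the orthogonality sum over the
    rationals. *)
Lemma cut_cycle_not1 i j b c x : (i <= j <= r)%N -> private b -> private c ->
  cut i j :&: dual_cycle b c = [set x] -> False.
Proof.
move=> hij pb pc eqx; have := cut_cycle_orthogonal rat hij pb pc.
have : x \in cut i j :&: dual_cycle b c by rewrite eqx set11.
rewrite inE => /andP[xC xD].
rewrite (bigD1 x) //= big1 ?addr0; last first.
  move=> y nyx; have : y \notin cut i j :&: dual_cycle b c by rewrite eqx inE.
  rewrite inE negb_and => /orP[/(cut_vec_sign rat _ _ _).2 ->|].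
    by rewrite mul0r.
  by move=> /(cycle_vec_sign rat _ _ _).2 ->; rewrite mulr0.
case: ((cut_vec_sign rat i j x).1 xC) => ->;
by case: ((cycle_vec_sign rat b c x).1 xD) => -> /eqP.
Qed.

Lemma indepP (A : {set T}) : reflect
  (A \subset S /\ forall i j, (i <= j <= r)%N -> ~~ (cut i j \subset A)) (indep N A).
Proof.
apply: (iffP andP) => [[AS /forall_inP H]|[AS H]]; split=> //.
  by move=> i j hij; apply: H; apply/circuitsE; exists i, j.
by apply/forall_inP => C /circuitsE[i [j [hij ->]]]; apply: H.
Qed.

(** * Size bounds for sets without dual cycles and for sets meeting all cuts *)

Section Counting.
Variable H : {set T}.
Hypothesis HS : H \subset S.

(* [gap] is injective on [H] when [H] contains no dual cycle and onto when [H]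
   meets all cuts, which gives both bounds on [#|H|]. *)
Definition gap (x : T) : 'I_r.+1 :=
  if tau x == r.+1 then
    [arg min_(l < ord_max | (sg x <= l)%N && ((l == r :> nat) || (q l \notin H))) l]
  else inord (sg x).

(** From [sg x], walk to the right as long as the path elements lie in [H]; [gap x] is the vertex
    where the walk stops, at [r] at the latest. *)
Lemma gapP x : private x ->
  [/\ (sg x <= gap x)%N, (gap x == r :> nat) || (q (gap x) \notin H) &
      forall l, (sg x <= l < gap x)%N -> (q l \in H) && (l < r)%N].
Proof.
move=> /andP[xS tx]; rewrite /gap tx; case: arg_minnP => [|l /andP[h1 h2] hmin].
  by rewrite /= sg_le // eqxx.
split=> // l' /andP[h3 h4].
have hl' : (l' < r.+1)%N by apply: ltn_trans h4 _.
have := hmin (Ordinal hl'); rewrite /= h3 /=.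
by case: (q l' \in H) => /=; have := ltn_ord l; lia.
Qed.

Lemma card_no_dual_cycle :
  (forall b c, private b -> private c -> b != c -> ~~ (dual_cycle b c \subset H)) ->
  (#|H| <= r.+1)%N.
Proof.
move=> no_cyc; rewrite -[X in (_ <= X)%N]card_ord -(@card_in_imset _ _ gap H) ?max_card //.
have inner_private x y : x \in H -> y \in H -> tau x != r.+1 -> private y -> gap x = gap y -> False.
  move=> xH yH tx /gapP[_ h _] eq_g; have xS := subsetP HS _ xH.
  have lt_x := inner_lt xS tx; move: h; rewrite -eq_g /gap (negbTE tx) inordK; last lia.
  by rewrite -innerE // xH orbF; lia.
move=> x y xH yH eq_g; have [xS yS] := (subsetP HS _ xH, subsetP HS _ yH).
have [tx|tx] := boolP (tau x == r.+1); have [ty|ty] := boolP (tau y == r.+1).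
(* If the walks from two outer edges stop at the same vertex, all path elements between their
   starting points lie in [H], so [H] contains their dual cycle. *)
- have [//|nxy] := eqVneq x y.
  have [px py] : private x /\ private y by rewrite /private xS yS.
  case/negP: (no_cyc x y px py nxy); apply/subsetP => z.
  rewrite inE => /andP[zS]; case: ifP => [_|/negbT tz].
    by case: eqP => [->//|_]; case: eqP => [->|].
  have [hx1 _ hx] := gapP px; have [hy1 _ hy] := gapP py; rewrite eq_g in hx1 hx.
  move=> hxy; rewrite (innerE tz).
  have [hz|hz] : (sg x <= sg z < gap y)%N \/ (sg y <= sg z < gap y)%N by lia.
    by case/andP: (hx _ hz).
  by case/andP: (hy _ hz).
- by case: (inner_private y x yH xH ty); rewrite /private ?xS.
- by case: (inner_private x y xH yH tx); rewrite /private ?yS.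
move: eq_g; rewrite /gap (negbTE tx) (negbTE ty) => /(congr1 val).
rewrite /= !inordK; try by [have := inner_lt xS tx; lia | have := inner_lt yS ty; lia].
by rewrite {2}(innerE tx) {2}(innerE ty) => ->.
Qed.

Lemma card_hitting :
  (forall i j, (i <= j <= r)%N -> H :&: cut i j != set0) -> (r.+1 <= #|H|)%N.
Proof.
move=> hit; apply: leq_trans (leq_imset_card gap H).
rewrite -[X in (X <= _)%N]card_ord -cardsT; apply/subset_leq_card/subsetP => l _.
have hl : (l <= r)%N by rewrite -ltnS.
have [/andP[qlH ltlr]|hq] := boolP ((q l \in H) && (l < r)%N).
  apply/imsetP; exists (q l) => //; rewrite /gap tau_q // eqSS (ltn_eqF ltlr) sg_q //.
  by rewrite inord_val.
(* Extend to the left of [l] while the path elements lie in [H], down to [i]. Then [H] meets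
   [cut i l]; by minimality of [i] not in the path element before [i], hence in an outer edge whose
   walk stops at [l]. *)
pose P i := (i <= l)%N && [forall m : 'I_r.+1, (i <= m < l)%N ==> (q m \in H)].
have exP : exists i, P i.
  by exists l; rewrite /P leqnn; apply/forallP => m; apply/implyP; lia.
case: (ex_minnP exP) => i /andP[le_il /forallP run] imin.
have {}run m : (i <= m < l)%N -> q m \in H.
  move=> hm; have hm' : (m < r.+1)%N by lia.
  exact: (implyP (run (Ordinal hm')) hm).
have /set0Pn[b] := hit i l (introT andP (conj le_il hl)).
rewrite inE => /andP[bH bcut]; have bS := subsetP HS _ bH.
have [pb hb] : private b /\ (i <= sg b <= l)%N.
  move: bcut; rewrite mem_cut ?le_il // /private bS /= /tau.
  case: eqP => [eb|_ ->]; last by rewrite eqxx.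
  move=> /orP[/eqP sb|/eqP sb].
    move: hq; rewrite -sb -eb bH /= => hr; rewrite -sb in le_il.
    by split; [have := sg_le bS; lia | lia].
  have: (i <= (sg b))%N; last by lia.
  apply: imin; rewrite /P; apply/andP; split; first by lia.
  apply/forallP => m; apply/implyP => hm.
  have [->|nm] := eqVneq (m : nat) (sg b); first by rewrite -eb.
  apply: run; lia.
apply/imsetP; exists b => //; apply/val_inj => /=.
have [h1 h2 h3] := gapP pb; apply/eqP; rewrite eqn_leq; apply/andP; split; rewrite leqNgt; apply/negP => h.
  have := run (gap b); have := ltn_ord (gap b).
  by case/orP: h2 => [|/negbTE ->]; lia.
have := h3 l; move: hq; rewrite negb_and; case: (q l \in H); lia.
Qed.
End Counting.

(** * Bases and cocircuits *)

Lemma indep_card A : indep N A -> (#|A| + r.+1 <= #|S|)%N.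
Proof.
move=> /indepP[AS hA]; rewrite -(cardsID A S) (setIidPr AS) leq_add2l.
(* The complement of an independent set meets every cut. *)
apply: card_hitting; first exact: subsetDl.
move=> i j /hA /subsetPn[x xc xA]; apply/set0Pn; exists x.
by rewrite in_setI in_setD xA xc andbT; move: xc; rewrite inE => /andP[].
Qed.

Lemma basis_of_card A : indep N A -> #|S| = (#|A| + r.+1)%N -> is_basis N A.
Proof.
move=> iA cA; apply/andP; split=> //; apply/forallP => A'; apply/implyP => /andP[iA' sub].
by rewrite eq_sym eqEcard sub; have := indep_card iA'; rewrite cA; lia.
Qed.

(** Otherwise enlarge [D] to a maximal [X] without dual cycles. If the complement of [X] contained
    [cut i j], then adding [q j] to [X] would create a dual cycle meeting this cut only in [q j]. So
    the complement is independent. *)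
Lemma meets_dual_cycle D : meets_all_bases N D ->
  exists b c, [/\ private b, private c, b != c & dual_cycle b c \subset D].
Proof.
move=> /andP[/andP[_ DS] /forallP hD].
pose acyclic (X : {set T}) := (X \subset S) &&
  ~~ [exists b, exists c, [&& private b, private c, b != c & dual_cycle b c \subset X]].
have [aD|] := boolP (acyclic D); last first.
  rewrite /acyclic DS negbK => /existsP[b /existsP[c /and4P[? ? ? ?]]].
  by exists b, c.
have [X /maxsetP[/andP[XS aX] maxX] DX] := maxset_exists aD.
have {}aX b c : private b -> private c -> b != c -> ~~ (dual_cycle b c \subset X).
  by move=> pb pc nbc; apply: contra aX => sub; apply/existsP; exists b; apply/existsP; exists c; apply/and4P.
have iW : indep N (S :\: X).
  apply/indepP; split; first exact: subsetDl.
  move=> i j hij; apply/negP => sub.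
  have [xC xX] : q j \in cut i j /\ q j \notin X.
    have xC : q j \in cut i j by rewrite q_cut ?eqxx //; case/andP: hij.
    by split=> //; have := subsetP sub _ xC; rewrite inE => /andP[].
  have jr : (j <= r)%N by case/andP: hij.
  have [aX'|] := boolP (acyclic (q j |: X)).
    by move: xX; rewrite -(maxX _ aX' (subsetUr _ _)) setU11.
  rewrite /acyclic subUset sub1set q_in // XS negbK => /existsP[b /existsP[c /and4P[pb pc nbc sub']]].
  apply: (@cut_cycle_not1 i j b c (q j) hij pb pc); apply/setP => y; rewrite in_setI in_set1.
  apply/andP/eqP => [[yC yD]|->].
    have := subsetP sub' _ yD; have := subsetP sub _ yC.
    by rewrite !inE => /andP[/negbTE -> _]; rewrite orbF => /eqP.
  split=> //; apply/negPn/negP => nD; case/negP: (aX _ _ pb pc nbc).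
  apply/subsetP => v vD; have := subsetP sub' _ vD; rewrite in_setU1 => /predU1P[ev|//].
  by rewrite -ev vD in nD.
(* The two counting bounds force [X] to have [r.+1] elements, so its complement is a basis, and it
   misses [D]. *)
have cW : #|S| = (#|S :\: X| + r.+1)%N.
  have := card_no_dual_cycle XS aX; have := indep_card iW; rewrite -(cardsID X S) (setIidPr XS); lia.
have := implyP (hD _) (basis_of_card iW cW); case/set0Pn=> x; rewrite !inE => /and3P[xD xX _].
by rewrite (subsetP DX) in xX.
Qed.

(** If a basis [B] missed the cycle, adding [b] would create a circuit meeting the cycle only in
    [b]. *)
Lemma dual_cycle_meets b c : private b -> private c -> b != c ->
  meets_all_bases N (dual_cycle b c).
Proof.
move=> pb pc nbc; have bD := mem_dual_cyclel pb nbc.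
apply/andP; split.
  apply/andP; split; first by apply/set0Pn; exists b.
  by apply/subsetP => x; rewrite inE => /andP[].
apply/forallP => B; apply/implyP => /andP[iB /forallP maxB]; apply/negP => /eqP dis.
have nB x : x \in dual_cycle b c -> x \notin B.
  by move=> xD; apply/negP => xB; have := in_set0 x; rewrite -dis inE xD xB.
have [/indepP[BS hB]] := (iB).
have [iB'|/negP] := boolP (indep N (b |: B)).
  have := maxB (b |: B); rewrite iB' subsetUr => /eqP eB.
  by have := nB _ bD; rewrite -eB setU11.
apply; apply/indepP; split; first by rewrite subUset sub1set private_mem.
move=> i j hij; apply/negP => sub; apply: (@cut_cycle_not1 i j b c b hij pb pc).
have sub1 y : y \in cut i j -> y \in dual_cycle b c -> y = b.
  by move=> /(subsetP sub); rewrite in_setU1 => /predU1P[//|yB] /nB; rewrite yB.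
apply/setP => y; rewrite in_setI in_set1; apply/andP/eqP => [[]|->]; first exact: sub1.
split=> //; apply/negPn/negP => nC; case/negP: (hB _ _ hij).
apply/subsetP => v vC; have := subsetP sub _ vC; rewrite in_setU1 => /predU1P[ev|//].
by rewrite -ev vC in nC.
Qed.

Lemma dual_cycle_sub b c b' c' :
  private b -> private c -> b != c -> private b' -> private c' ->
  b' != c' -> dual_cycle b' c' \subset dual_cycle b c ->
  (b' = b /\ c' = c) \/ (b' = c /\ c' = b).
Proof.
move=> pb pc nbc pb' pc' nbc' /subsetP sub.
have := dual_cycle_private pb' (sub _ (mem_dual_cyclel pb' nbc')).
have : c' \in dual_cycle b' c' by rewrite dual_cycleC mem_dual_cyclel // eq_sym.
move=> /sub /(dual_cycle_private pc') [] hc [] hb; subst; auto; by rewrite eqxx in nbc'.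
Qed.

(** Sets meeting all bases contain dual cycles, and no dual cycle properly contains another, since
    its two outer edges determine it. *)
Lemma cocircuitsP D : reflect
  (exists b c, [/\ private b, private c, b != c & D = dual_cycle b c])
  (D \in cocircuits N).
Proof.
rewrite inE; apply: (iffP andP) => [[mD /forallP minD]|[b [c [pb pc nbc ->]]]].
  have [b [c [pb pc nbc sub]]] := meets_dual_cycle mD; exists b, c; split=> //.
  apply/eqP; rewrite eqEsubset sub andbT; apply/negPn/negP => nsub.
  have := minD (dual_cycle b c); rewrite properE sub nsub /=.
  by rewrite dual_cycle_meets.
split; first exact: dual_cycle_meets.
apply/forallP => D'; apply/implyP => ltD; apply/negP => mD.
have [b' [c' [pb' pc' nbc' sub]]] := meets_dual_cycle mD.
move: ltD; rewrite properE => /andP[subD /negP]; apply.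
have [] := dual_cycle_sub pb pc nbc pb' pc' nbc' (subset_trans sub subD).
  by move=> [e1 e2]; rewrite -e1 -e2.
by move=> [e1 e2]; rewrite -e1 -e2 dual_cycleC.
Qed.

(** The pair [b], [c] is chosen separately for each cocircuit, so [astar] is known only up to the
    orientation of the cycle; [theta_nonq] absorbs this sign into a scalar. *)
Lemma admissible_exists (k : fieldType) : exists astar : {set T} -> T -> k,
  admissible N astar /\
  forall D, D \in cocircuits N -> exists b c,
    [/\ private b, private c, b != c, D = dual_cycle b c & astar D =1 cycle_vec k b c].
Proof.
have /fin_all_exists[astar Ha] : forall D, exists g : T -> k, D \in cocircuits N ->
   exists b c, [/\ private b, private c, b != c, D = dual_cycle b c & g =1 cycle_vec k b c].
  move=> D; have [/cocircuitsP[b [c [pb pc nbc ->]]]|_] := boolP (D \in cocircuits N).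
    by exists (cycle_vec k b c) => _; exists b, c.
  by exists (fun=> 0).
have /fin_all_exists[f Hf] : forall C, exists g : T -> k, C \in circuits N ->
   exists i j, [/\ (i <= j <= r)%N, C = cut i j & g =1 cut_vec k i j].
  move=> C; have [/circuitsE[i [j [hij ->]]]|_] := boolP (C \in circuits N).
    by exists (cut_vec k i j) => _; exists i, j.
  by exists (fun=> 0).
exists astar; split=> //; split.
  by move=> D x /Ha [b [c [pb pc nbc -> ->]]]; apply: cycle_vec_sign.
exists f; split; first by move=> C x /Hf [i [j [hij -> ->]]]; apply: cut_vec_sign.
move=> C D /Hf [i [j [hij _ fE]]] /Ha [b [c [pb pc nbc _ aE]]].
rewrite -[RHS](cut_cycle_orthogonal k hij pb pc).
by apply: eq_bigr => x _; rewrite fE aE.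
Qed.

(** * Orderings that start with the path: fundamental circuits and cocircuits *)

Section Ordering.
Variable e : 'I_#|S| -> T.
Local Notation m := #|S|.
Hypothesis e_inj : injective e.
Hypothesis e_in : forall i, e i \in S.
Hypothesis r_lt_m : (r < m)%N.
Hypothesis e_q : forall i : 'I_m, (i <= r)%N -> e i = q i.

Definition qi (l : 'I_r.+1) : 'I_m := widen_ord r_lt_m l.

Lemma e_onto x : x \in S -> exists i, e i = x.
Proof.
move=> xS; have sub : e @: setT \subset S by apply/subsetP => y /imsetP[i _ ->].
have /eqP eS : e @: setT == S.
  by rewrite eqEcard sub card_imset // cardsT card_ord leqnn.
have : x \in e @: setT by rewrite eS.
by case/imsetP=> i _ ->; exists i.
Qed.

Lemma e_qi l : e (qi l) = q l.
Proof. by rewrite e_q //= -ltnS. Qed.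

Lemma qi_inord (i : 'I_m) : (i <= r)%N -> qi (inord i) = i.
Proof. by move=> hi; apply: val_inj; rewrite /= inordK. Qed.

Lemma e_qP (i : 'I_m) : (e i == q (sg (e i))) = (i <= r)%N.
Proof.
apply/eqP/idP => [|hi]; last by rewrite e_q // sg_q.
have hs : (sg (e i) < r.+1)%N by rewrite ltnS sg_le.
by rewrite -(e_qi (Ordinal hs)) => /e_inj ->; rewrite /= -ltnS.
Qed.

Lemma private_nq x : x \in S -> x != q (sg x) -> private x.
Proof. by rewrite /private /tau => -> /negbTE ->; rewrite eqxx. Qed.

Definition nonq : {set T} := [set x in S | x != q (sg x)].

Lemma nonq_indep : indep N nonq.
Proof.
apply/indepP; split; first by apply/subsetP => x; rewrite inE => /andP[].
move=> i j hij; apply/negP => /subsetP /(_ (q j)).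
have jr : (j <= r)%N by case/andP: hij.
by rewrite q_cut // eqxx inE sg_q // eqxx andbF => /(_ isT).
Qed.

Lemma nonq_card : m = (#|nonq| + r.+1)%N.
Proof.
have nS : nonq \subset S by apply/subsetP => x; rewrite inE => /andP[].
apply/eqP; rewrite eqn_leq (indep_card nonq_indep) andbT.
rewrite -[X in (X <= _)%N](cardsID nonq S) (setIidPr nS) leq_add2l.
rewrite -[X in (_ <= X)%N]card_ord; pose h (l : 'I_r.+1) := q l.
apply: leq_trans (leq_imset_card h predT); apply: subset_leq_card.
apply/subsetP => x; rewrite !inE => /andP[h1 xS]; move: h1; rewrite xS negbK => /eqP ex.
have hs : (sg x < r.+1)%N by rewrite ltnS sg_le.
by apply/imsetP; exists (Ordinal hs).
Qed.

Lemma corank : (m - mrank N)%N = r.+1.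
Proof.
suff -> : mrank N = #|nonq| by rewrite {1}nonq_card addKn.
apply/eqP; rewrite eqn_leq (@leq_bigmax_cond _ _ _ nonq) ?nonq_indep // andbT.
apply/bigmax_leqP => A /indep_card; rewrite nonq_card; lia.
Qed.

Lemma BsetE : Bset e = nonq.
Proof.
apply/setP => x; rewrite inE; apply/imsetP/andP => [[i]|[xS nx]].
  by rewrite inE corank => hi ->; rewrite e_in e_qP -ltnNge.
have [i ei] := e_onto xS; exists i => //.
by rewrite inE corank ltnNge -e_qP ei.
Qed.

Lemma Bset_basis : is_basis N (Bset e).
Proof. by rewrite BsetE; apply: basis_of_card; [exact: nonq_indep | exact: nonq_card]. Qed.

Lemma cut_inj_top i j i' j' : (i <= j <= r)%N -> (i' <= j' <= r)%N ->
  cut i j = cut i' j' -> i = 0%N -> i' = 0%N /\ j' = j.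
Proof.
move=> hij hij' eq_cut i0.
have := q_cut hij' (l := j'); rewrite -eq_cut q_cut //; last lia.
have := q_cut hij' (l := i'.-1); rewrite -eq_cut q_cut //; last lia.
by case: i' hij' {eq_cut} => [|i'] /= ?; lia.
Qed.

(** The path elements of [cut i j'] are [q j'] and, when [i] is positive, the one before [i]. A
    fundamental circuit has a single path element, which forces [i = 0]. *)
Lemma ci_q j : (j <= r)%N -> ci N (Bset e) (q j) = cut 0 j.
Proof.
move=> jr; rewrite BsetE /ci; case: pickP => [C /andP[/circuitsE[i [j' [hij ->]]] sub]|].
  have sub' l : (l <= r)%N -> q l \in cut i j' -> l = j.
    move=> hl /(subsetP sub); rewrite in_setU1 inE sg_q // eqxx andbF orbF => /eqP.
    exact: q_inj.
  have ej : j' = j by apply: sub'; [lia | rewrite q_cut //; lia].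
  case: i hij {sub} sub' => [|i] hij sub' /=; first by rewrite ej.
  by have := sub' i; rewrite q_cut //; lia.
move=> /(_ (cut 0 j)) /negP; case; apply/andP; split; first by apply/circuitsE; exists 0%N, j.
apply/subsetP => x xc; have xS : x \in S by move: xc; rewrite inE => /andP[].
move: xc; rewrite mem_cut // in_setU1 inE xS /=; case: eqP => [ex|_ _]; last by rewrite orbT.
by rewrite !orbF => /eqP sj; rewrite -sj; apply/eqP.
Qed.

(** Apart from [b], all elements of this cycle lie on the path. The outer edges of a competing cycle
    could only be [b] and [q r]. *)
Lemma coc_nonq b : b \in nonq -> coc N (Bset e) b = dual_cycle b (q r).
Proof.
rewrite BsetE => bn; have := bn; rewrite inE => /andP[bS nb].
have pb := private_nq bS nb; have nbq : b != q r.
  by apply: contra nb => /eqP ->; rewrite sg_q.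
rewrite /coc; case: pickP => [D /and3P[/cocircuitsP[b' [c' [pb' pc' nbc' ->]]] bD sub]|].
  have sub' y : private y -> y \in dual_cycle b' c' -> y = b \/ y = q r.
    move=> py /(subsetP sub); rewrite in_setU1 => /predU1P[->|]; first by left.
    rewrite !inE; case/andP: py => yS ty; rewrite yS /= andbT negbK => /eqP ey; right.
    rewrite ey; congr q; move: ty; rewrite /tau -ey eqxx eqSS => /eqP //.
  have c'D : c' \in dual_cycle b' c' by rewrite dual_cycleC mem_dual_cyclel // eq_sym.
  have := sub' _ pb' (mem_dual_cyclel pb' nbc'); have := sub' _ pc' c'D.
  case=> hc; case=> hb; rewrite hb hc ?eqxx // in nbc' *.
  exact: dual_cycleC.
move=> /(_ (dual_cycle b (q r))) /negP; case; apply/and3P; split.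
- by apply/cocircuitsP; exists b, (q r); split => //; apply: private_q.
- exact: mem_dual_cyclel.
apply/subsetP => x; rewrite inE => /andP[xS hx]; rewrite in_setU1 in_setD xS inE xS /= andbT negbK.
move: hx; case: ifP => [_|/negbT /innerE ex _]; last by rewrite -ex eqxx orbT.
by case: eqP => // _ /= /eqP ->; rewrite sg_q ?eqxx.
Qed.

(** * Broken circuits and the monomials of [L] *)

Definition face_basis (l : nat) : {set 'I_m} := [set x : 'I_m | (r < x)%N && (sg (e x) == l)].
(* The index set [Cbar e (cut l l)], see [Cbar_cut_diag]. *)
Definition face_bar (l : nat) : {set 'I_m} :=
  [set x : 'I_m | if (x <= r)%N then (x == l :> nat) && (0 < l)%N else sg (e x) == l].

Lemma card_face_bar l : (l <= r)%N -> #|face_bar l| = ((0 < l) + #|face_basis l|)%N.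
Proof.
move=> hl; have hl' : (l < m)%N by lia.
rewrite -(cardsID (face_basis l) (face_bar l)) addnC; congr (_ + _)%N.
  case: ltnP => [l0|l0].
    rewrite (_ : _ :\: _ = [set Ordinal hl']) ?cards1 //; apply/setP => x.
    by rewrite !inE -val_eqE /=; case: (leqP x r); case: (sg (e x) == l) => /=; lia.
  rewrite (_ : _ :\: _ = set0) ?cards0 //; apply/setP => x.
  by rewrite !inE; case: (leqP x r); case: (sg (e x) == l) => /=; lia.
by apply: eq_card => x; rewrite !inE; case: (leqP x r); case: (sg (e x) == l) => /=; lia.
Qed.

Lemma e_cut i j (x : 'I_m) : (i <= j <= r)%N ->
  (e x \in cut i j) = if (x <= r)%N then (x == j :> nat) || (x.+1 == i) else (i <= sg (e x) <= j)%N.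
Proof. by move=> hij; rewrite mem_cut // e_qP; case: ifP => // hx; rewrite e_q // sg_q. Qed.

(** The minimum of the cut is the path element before [i] when [i] is positive, and [q j] when
    [i = 0]; so [q j] survives only in the first case. *)
Lemma Cbar_cut i j : (i <= j <= r)%N ->
  Cbar e (cut i j) =
  [set x : 'I_m | if (x <= r)%N then (x == j :> nat) && (0 < i)%N else (i <= sg (e x) <= j)%N].
Proof.
move=> hij; apply/setP => x; rewrite /Cbar in_set e_cut // in_set.
case: (leqP x r) => hx /=.
  apply/andP/andP => [[h1 /existsP[y /andP[lt_yx]]]|[/eqP h1 h2]].
    by rewrite e_cut //; case: ifP => hy h2; lia.
  have hi : (i.-1 < m)%N by lia.
  split; first by lia.
  by apply/existsP; exists (Ordinal hi); rewrite e_cut //= ifT; lia.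
apply: andb_idr => _; have hj : (j < m)%N by lia.
by apply/existsP; exists (Ordinal hj); rewrite e_cut //= ifT; lia.
Qed.

Lemma Cbar_cut_diag l : (l <= r)%N -> Cbar e (cut l l) = face_bar l.
Proof.
move=> hl; rewrite Cbar_cut ?leqnn //; apply/setP => x; rewrite !inE.
by case: ifP => // _; rewrite -eqn_leq eq_sym.
Qed.

(** Every broken circuit contains that of a single face, so the cuts [cut l l] already generate the
    broken-circuit ideal. *)
Lemma face_bar_sub_Cbar i j : (i <= j <= r)%N ->
  face_bar (if i == 0%N then 0%N else j) \subset Cbar e (cut i j).
Proof.
move=> hij; rewrite Cbar_cut //; apply/subsetP => x; rewrite !inE.
by case: ifP; case: ifP => ? ?; lia.
Qed.

Lemma dj_q (x : 'I_m) : (x <= r)%N -> dj e x = x.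
Proof. by move=> hx; rewrite /dj corank ltnS hx. Qed.

Lemma e_nonq (x : 'I_m) : (r < x)%N -> e x \in nonq.
Proof. by move=> hx; rewrite inE e_in e_qP -ltnNge. Qed.

(** The fundamental cocircuit contains exactly the path elements from [sg (e x)] onwards, and these
    precede all basis elements in the ordering. *)
Lemma dj_nonq (x : 'I_m) : (r < x)%N -> dj e x = sg (e x) :> nat.
Proof.
move=> hx; rewrite /dj corank ltnS leqNgt hx /= coc_nonq ?e_nonq //.
set D := dual_cycle _ _; have qD (i : 'I_m) : (i <= r)%N -> (e i \in D) = (sg (e x) <= i)%N.
  move=> hi; rewrite inE e_in /= e_q // tau_q // sg_q // [sg (q r)]sg_q // eqSS.
  have [->|ni] := eqVneq (i : nat) r.
    rewrite eqxx sg_le // (negbTE (_ : q r != e x)) //.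
    have := e_nonq hx; rewrite inE => /andP[_]; apply: contra => /eqP <-.
    by rewrite sg_q.
  have -> : (r <= i)%N = false by lia.
  by rewrite addbF.
have hs : (sg (e x) <= r)%N by apply: sg_le.
have hs' : (sg (e x) < m)%N by lia.
rewrite /min_index; case: pickP => [i /andP[h1 /forallP h2]|].
  have [hi|hi] := leqP i r; last first.
    have := h2 (Ordinal hs'); rewrite qD //= leqnn /=; lia.
  rewrite qD // in h1; have := h2 (Ordinal hs'); rewrite qD //= leqnn /=; lia.
move=> /(_ (Ordinal hs')) /negP; case; rewrite qD //= leqnn /=.
apply/forallP => i'; apply/implyP => hi'; rewrite qD //; lia.
Qed.

Lemma dj_face_bar l (x : 'I_m) : (l <= r)%N -> x \in face_bar l -> dj e x = l :> nat.
Proof.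
move=> hl; rewrite inE; case: (leqP x r) => hx; first by rewrite dj_q // => /andP[/eqP ->].
by rewrite dj_nonq // => /eqP ->.
Qed.

Lemma mC_cut0 j (i : 'I_m) : (j <= r)%N ->
  mC e (cut 0 j) i = if i == j :> nat then #|Cbar e (cut 0 j)| else 0%N.
Proof.
move=> jr; rewrite /mC corank; case: pickP => [i0 /andP[hi0 /eqP]|].
  rewrite ltnS in hi0; rewrite e_q // ci_q // => eq_cut.
  have [_ ei0] := @cut_inj_top 0 j 0 i0 jr hi0 eq_cut (erefl _).
  by rewrite mnmE -val_eqE /= ei0.
have hj : (j < m)%N by lia.
move=> /(_ (Ordinal hj)); rewrite /= ltnS jr /= e_q //= ci_q // eqxx //.
Qed.

Lemma mC_cut_pos i j (x : 'I_m) : (0 < i <= j)%N -> (j <= r)%N ->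
  mC e (cut i j) x = #|[set y in Cbar e (cut i j) | dj e y == x]|.
Proof.
move=> hij jr; rewrite /mC corank; case: pickP => [i0 /andP[hi0 /eqP]|]; last by rewrite mnmE.
rewrite ltnS in hi0; rewrite e_q // ci_q // => /esym eq_cut.
have hij' : (i <= j <= r)%N by lia.
by have [i00 _] := @cut_inj_top 0 i0 i j hi0 hij' eq_cut (erefl _); lia.
Qed.

Hypothesis a0_ex : exists x, [/\ x \in S, sg x = 0%N & x != q 0].

Definition boxd (x : 'I_m) : nat := if (x <= r)%N then #|face_bar x| else 1%N.

(** For positive [j], the element [q j] belongs to [face_bar j] but not to the other set; the basis
    element on face 0 given by [a0_ex] makes up for it. *)
Lemma card_face_bar_Cbar0 j : (j <= r)%N -> (#|face_bar j| <= #|Cbar e (cut 0 j)|)%N.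
Proof.
move=> jr; case: (posnP j) => [->|j0]; first by rewrite Cbar_cut_diag.
have [x [xS sx nx]] := a0_ex; have [i ei] := e_onto xS.
have hi : (r < i)%N by rewrite ltnNge -e_qP ei sx.
rewrite card_face_bar // j0 -(_ : #|i |: face_basis j| = 1 + #|face_basis j|)%N; last first.
  by rewrite cardsU1 inE ei sx; case: eqP => [ej|]; rewrite ?andbF //; lia.
apply/subset_leq_card/subsetP => y; rewrite Cbar_cut // !inE.
case/predU1P => [->|/andP[hy /eqP ->]]; last by rewrite leqNgt hy /= leqnn.
by rewrite leqNgt hi /= ei sx.
Qed.

(** The cuts [cut x x] yield the box conditions. Conversely, [mC] of any [cut i j] has exponent at
    least [#|face_bar j|] at index [j], so it divides no monomial of the box. *)
Lemma inL_box (mo : 'X_{1..m}) : inL e mo = [forall x, mo x < boxd x]%N.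
Proof.
apply/andP/forallP => [[/forallP hz /forall_inP hC] x|hbox].
  rewrite /boxd; case: (leqP x r) => hx; last first.
    by have := hz x; rewrite corank hx /= => /eqP ->.
  have : cut x x \in circuits N by apply/circuitsE; exists x, x; rewrite leqnn.
  move=> /hC /forallPn[y]; rewrite -ltnNge.
  have [x0|x0] := posnP x.
    rewrite x0 mC_cut0 //; case: eqP => // y0.
    by rewrite Cbar_cut_diag // (_ : y = x) //; apply: val_inj; rewrite /= y0 x0.
  rewrite mC_cut_pos ?x0 ?leqnn // Cbar_cut_diag //.
  have [->|ny] := eqVneq y x.
    by move/leq_trans; apply; apply/subset_leq_card/subsetP => z; rewrite inE => /andP[].
  rewrite (_ : [set _ in _ | _] = set0) ?cards0 //; apply/setP => z; rewrite in_set in_set0.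
  apply/negP => /andP[/(dj_face_bar hx) ez /eqP ey].
  by case/eqP: ny; apply: val_inj; rewrite /= -ey ez.
split.
  apply/forallP => x; apply/implyP; rewrite corank => hx; have := hbox x.
  by rewrite /boxd (leqNgt x r) hx /= ltnS leqn0.
apply/forall_inP => C /circuitsE[i [j [hij ->]]]; apply/forallPn.
have jr : (j <= r)%N by lia.
have hj : (j < m)%N by lia.
exists (Ordinal hj); rewrite -ltnNge; apply: leq_trans (hbox _) _; rewrite /boxd /= jr.
case: i hij => [|i] hij; first by rewrite mC_cut0 // eqxx card_face_bar_Cbar0.
rewrite mC_cut_pos; [|lia|exact: jr]; apply/subset_leq_card/subsetP => y yU; rewrite inE.
by rewrite (subsetP (face_bar_sub_Cbar hij) _ yU) -val_eqE /= (dj_face_bar jr yU).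
Qed.

(** * The quotient algebra: spanning and independence of [L] *)

Section Algebra.
Variables (k : fieldType) (astar : {set T} -> T -> k).
Hypothesis astarE : forall D, D \in cocircuits N -> exists b c,
  [/\ private b, private c, b != c, D = dual_cycle b c & astar D =1 cycle_vec k b c].

Definition tail_sum (l : nat) : {mpoly k[m]} := \sum_(l' < r.+1 | (l <= l')%N) 'X_(qi l').

Lemma sum_index_le (V : zmodType) (P : pred nat) (F : 'I_m -> V) :
  \sum_(x : 'I_m | (x <= r)%N && P x) F x = \sum_(l < r.+1 | P l) F (qi l).
Proof.
rewrite (eq_bigl (mem (qi @: [set l : 'I_r.+1 | P l]))); last first.
  move=> x; apply/andP/imsetP => [[hx Px]|[l]].
    by exists (inord x); rewrite ?inE ?qi_inord // inordK.
  by rewrite inE => Pl -> /=; rewrite leq_ord.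
rewrite big_imset /=; last by move=> l l' _ _ /(congr1 val) /= /val_inj.
by apply: eq_bigl => l; rewrite inE.
Qed.

(** The flow through [e x] and [q r] takes the value 1 at [e x] and -1 at each path element from
    [sg (e x)] on. The scalar [c] is the sign of the orientation chosen by [astar]. *)
Lemma theta_nonq (x : 'I_m) : (r < x)%N ->
  exists2 c : k, c != 0 & theta e astar x = c *: ('X_x - tail_sum (sg (e x))).
Proof.
move=> hx; have bn := e_nonq hx; have := bn; rewrite inE => /andP[bS nb].
have pb := private_nq bS nb; have nbq : e x != q r.
  by apply: contra nb => /eqP ->; rewrite sg_q.
have vecE : \sum_(i < m) cycle_vec k (e x) (q r) (e i) *: 'X_i
            = 'X_x - tail_sum (sg (e x)) :> {mpoly k[m]}.
  rewrite (bigID (fun i : 'I_m => (i <= r)%N)) /= addrC; congr (_ + _).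
    rewrite (bigD1 x) /=; last by rewrite -ltnNge.
    rewrite big1 ?addr0; last first.
      move=> i /andP[hi nix]; rewrite /cycle_vec e_in /=.
      have /andP[_ ->] : private (e i) by apply: private_nq => //; rewrite e_qP.
      rewrite (inj_eq e_inj) (negbTE nix) (negbTE (_ : e i != q r)) ?subrr ?scale0r //.
      by apply/eqP => eiq; move: hi; rewrite -e_qP eiq sg_q ?eqxx.
    rewrite /cycle_vec e_in; case/andP: pb => _ -> /=.
    by rewrite eqxx (negbTE nbq) subr0 scale1r.
  rewrite /tail_sum -(sum_index_le (fun l => (sg (e x) <= l)%N) (fun i => 'X_i)).
  rewrite -sumrN [RHS]big_mkcondr; apply: eq_bigr => i hi.
  rewrite /cycle_vec e_in /= e_q // tau_q // !sg_q // eqSS.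
  have [ei|ni] := eqVneq (i : nat) r.
    rewrite ei sg_le // eqxx eq_sym (negbTE nbq) sub0r scaleN1r //.
  have -> : (r <= i)%N = false by lia.
  by case: ifP; rewrite ?subrr ?scale0r // sub0r scaleN1r.
have cocD : dual_cycle (e x) (q r) \in cocircuits N.
  by apply/cocircuitsP; exists (e x), (q r); split=> //; apply: private_q.
rewrite /theta coc_nonq //; have [b [c [pb' pc' nbc eD aE]]] := astarE cocD.
have -> : \sum_(i : 'I_m | e i \in dual_cycle (e x) (q r))
    astar (dual_cycle (e x) (q r)) (e i) *: 'X_i
   = \sum_(i < m) cycle_vec k b c (e i) *: 'X_i :> {mpoly k[m]}.
  rewrite big_mkcond; apply: eq_bigr => i _; rewrite aE; case: ifP => // /negbT.
  by rewrite eD => /((cycle_vec_sign k b c (e i)).2) ->; rewrite scale0r.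
have [] := dual_cycle_sub pb private_q nbq pb' pc' nbc.
- by rewrite eD.
- by case=> -> ->; exists 1; rewrite ?oner_eq0 // vecE scale1r.
case=> -> ->; exists (-1); first by rewrite oppr_eq0 oner_eq0.
rewrite -vecE scaleN1r -sumrN; apply: eq_bigr => i _.
by rewrite cycle_vecN scaleNr.
Qed.

Local Notation gens := (BC_gens e astar).
Local Notation ideal := (@in_ideal T k N gens).

Lemma BC_gensP g : g \in gens ->
  (exists i j, (i <= j <= r)%N /\ g = \prod_(x in Cbar e (cut i j)) 'X_x) \/
  (exists2 x : 'I_m, (r < x)%N & g = theta e astar x).
Proof.
rewrite mem_cat => /orP[/mapP[C]|/mapP[x]].
  by rewrite mem_enum => /circuitsE[i [j [hij ->]]] ->; left; exists i, j.
by rewrite mem_filter corank => /andP[hx _] ->; right; exists x.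
Qed.

Lemma ideal_face_bar l : (l <= r)%N -> ideal (\prod_(x in face_bar l) 'X_x).
Proof.
move=> hl; rewrite -Cbar_cut_diag //; apply: in_ideal_mem; rewrite mem_cat.
apply/orP; left; apply/mapP; exists (cut l l) => //.
by rewrite mem_enum; apply/circuitsE; exists l, l; rewrite leqnn.
Qed.

Lemma ideal_nonq (x : 'I_m) : (r < x)%N -> ideal ('X_x - tail_sum (sg (e x))).
Proof.
move=> hx; have [c c0 eth] := theta_nonq hx.
have : ideal (theta e astar x).
  apply: in_ideal_mem; rewrite mem_cat; apply/orP; right; apply/mapP; exists x => //.
  by rewrite mem_filter corank hx mem_enum.
move=> /(in_idealMl (c^-1)%:MP); rewrite eth mul_mpolyC scalerA mulVf // scale1r.
exact.
Qed.

(** Stated over any ring because it serves twice: for the reducers, and for the images of the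
    broken-circuit monomials in the polynomial tower. *)
Lemma prod_face_bar (A : comNzRingType) (y : 'I_m -> A) (s : nat -> A) (l : 'I_r.+1) :
  \prod_(x in face_bar l) (if (x <= r)%N then y x else s (sg (e x)))
  = y (qi l) ^+ (0 < l)%N * s l ^+ #|face_basis l|.
Proof.
rewrite (bigID (fun x : 'I_m => (x <= r)%N)) /=; congr (_ * _).
  have [l0|l0] := posnP l.
    rewrite big_pred0 // => x; rewrite inE l0 andbF.
    by case: (leqP x r); rewrite ?andbF.
  have ler : (qi l <= r)%N by rewrite /= -ltnS.
  rewrite (eq_bigl (pred1 (qi l))) ?big_pred1_eq ?ler // => x.
  rewrite inE l0 andbT /= -val_eqE /=.
  by case: (leqP x r) => hx; rewrite ?andbT ?andbF //; move: hx ler => /=; lia.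
rewrite (eq_bigr (fun=> s l)); last first.
  by move=> x /andP[]; rewrite inE; case: ifP => // _ /eqP ->.
rewrite (eq_bigl (mem (face_basis l))) ?prodr_const // => x.
by rewrite !inE /= (ltnNge r x); case: (x <= r)%N => /=; rewrite ?andbF ?andbT.
Qed.

(* Every non-leading term of a reducer replaces variables of [q] by later ones,
   so it has smaller weight. *)
Definition wt (x : 'I_m) : nat := if (x <= r)%N then (r.+1 - x)%N else r.+2.

Definition reducer (x : 'I_m) : {mpoly k[m]} :=
  if (x <= r)%N then 'X_x ^+ (0 < x)%N * tail_sum x ^+ #|face_basis x|
  else 'X_x - tail_sum (sg (e x)).

Lemma ideal_reducer x : ideal (reducer x).
Proof.
rewrite /reducer; case: (leqP x r) => hx; last exact: ideal_nonq.
have := prod_face_bar (fun x => 'X_x) tail_sum (inord x); rewrite inordK // qi_inord // => <-.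
(* [P] is the broken-circuit monomial with its basis variables replaced by tail sums, a replacement
   that changes it only by an element of the ideal. *)
set P := \prod_(_ in _) _; rewrite -[P](subKr (\prod_(y in face_bar x) 'X_y)).
apply: in_idealD; first exact: ideal_face_bar.
apply/in_idealN/in_ideal_prodB => y _.
case: (leqP y r) => hy; first by rewrite subrr; apply: in_ideal0.
exact: ideal_nonq.
Qed.

Lemma tail_sum_weight l W : (r.+1 - l < W)%N -> weight_lt wt W (tail_sum l).
Proof.
move=> hW; apply: (big_ind (weight_lt wt W)) => [mo||l' hl']; first by rewrite msupp0.
  by move=> ? ?; apply: weight_ltD.
apply: weight_lt_le (@weight_ltX _ _ _ _ _); rewrite weight1 /wt /= leq_ord; lia.
Qed.

Lemma tail_sumS (x : 'I_m) : (x <= r)%N -> tail_sum x = 'X_x + tail_sum x.+1.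
Proof.
move=> hx; rewrite /tail_sum (bigD1 (inord x)) /= ?inordK // qi_inord //; congr (_ + _).
apply: eq_bigl => l; rewrite -val_eqE /= inordK //; lia.
Qed.

(** For a path index, [tail_sum x] is ['X_x] plus later variables, all of smaller weight. For a
    basis index, every term of the tail sum has weight at most [r.+1], below [wt x = r.+2]. *)
Lemma reducer_lead x : weight_lt wt (wt x * boxd x) (reducer x - 'X_x ^+ boxd x).
Proof.
rewrite /reducer /boxd; case: (leqP x r) => hx; last first.
  rewrite expr1 muln1 addrAC subrr add0r => mo; rewrite (perm_mem (msuppN _)).
  by apply: tail_sum_weight; rewrite /wt (leqNgt x r) hx /=; lia.
rewrite card_face_bar // exprD -mulrBr mulnDr.
have X_wt : weight_lt wt (wt x).+1 ('X_x : {mpoly k[m]}).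
  by rewrite -(weight1 wt); apply: weight_ltX.
have [] := weight_lt_prodB #|face_basis x| X_wt (@tail_sum_weight x.+1 (wt x) _).
  by rewrite /wt hx; lia.
rewrite -tail_sumS // => H _; apply: weight_ltM => //.
have [x0|x0] := posnP x; rewrite ?muln1 ?muln0 ?expr1 ?expr0 //.
by move=> mo; rewrite msupp1 inE => /eqP ->; rewrite /weight big1 // => i _; rewrite mnm0E muln0.
Qed.

Lemma L_spanning p : exists2 g, supported_on_L e g & ideal (p - g).
Proof.
have [g [hg Ig]] := box_spanning ideal_reducer reducer_lead p.
by exists g => // mo /hg; rewrite inL_box.
Qed.

(** Evaluate in the tower of [triangular_functionals]. The linear forms vanish there and the
    broken-circuit monomials become multiples of the triangular generators, so [L] kills the image
    of [g]; but it also reads off an arbitrary coefficient of [g]. *)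
Lemma L_independent g : supported_on_L e g -> ideal g -> g = 0.
Proof.
move=> gL Ig.
have [A [iota [z Hz]]] := triangular_functionals k r.+1
  (fun l => (0 < l)%N : nat) (fun l => #|face_basis l|).
pose s l := \sum_(l <= l' < r.+1) z l'.
(* Path variables go to the tower variables, basis variables to the tail sums that the linear forms
   dictate. *)
pose h (x : 'I_m) := if (x <= r)%N then z x else s (sg (e x)).
have box_lt mo : mo \in msupp g -> forall l : 'I_r.+1,
    (mo (qi l) < (0 < l)%N + #|face_basis l|)%N.
  move=> /gL; rewrite inL_box => /forallP H l; have := H (qi l).
  by rewrite /boxd /= leq_ord card_face_bar // -ltnS.
have mo_hi mo (x : 'I_m) : mo \in msupp g -> (r < x)%N -> mo x = 0%N.
  move=> /gL; rewrite inL_box => /forallP H hx; have := H x.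
  by rewrite /boxd (leqNgt x r) hx; case: (mo x).
have mmap1_h mo : mo \in msupp g -> mmap1 h mo = \prod_(l < r.+1) z l ^+ mo (qi (inord l)).
  move=> hmo; rewrite /mmap1 (bigID (fun x : 'I_m => (x <= r)%N)) /= [X in _ * X]big1 ?mulr1.
    rewrite (eq_bigl (mem (qi @: [set: 'I_r.+1]))); last first.
      move=> x; apply/idP/imsetP => [hx|[l _ ->]]; last by rewrite /= -ltnS.
      by exists (inord x); rewrite ?inE ?qi_inord.
    rewrite big_imset /=; last by move=> l l' _ _ /(congr1 val) /= /val_inj.
    apply: eq_big => l; first by rewrite inE.
    by rewrite /h /= leq_ord inord_val.
  by move=> x; rewrite -ltnNge => hx; rewrite (mo_hi mo) ?expr0.
apply/mpolyP => mo; rewrite mcoeff0; apply/eqP/negPn; rewrite -mcoeff_msupp; apply/negP => hmo.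
have [l hl|L [LD LZ LG LE]] := Hz (fun l => mo (qi (inord l))).
  by have := box_lt _ hmo (inord l); rewrite inordK.
have L0 : L 0 = 0 by apply: (addIr (L 0)); rewrite -LD !add0r.
have hk : L (mmap iota h g) = 0.
  apply: (@ideal_killed _ _ _ gens (fun p => L (mmap iota h p))) Ig => [x y|p c].
    by rewrite mmapD LD.
  move=> /BC_gensP[[i [j [hij ->]]]|[x hx ->]]; rewrite rmorphM /=; last first.
    have hxE : h x = s (sg (e x)) by rewrite /h (leqNgt x r) hx.
    have [d _ ->] := theta_nonq hx; rewrite mmapZ mmapB mmapX mmap1U hxE.
    rewrite rmorph_sum /= /s big_geq_mkord /=.
    rewrite [X in _ - X](eq_bigr (fun l' : 'I_r.+1 => z l')) ?subrr ?mulr0 // => l' _.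
    by rewrite mmapX mmap1U /h /= leq_ord.
  rewrite rmorph_prod /= (eq_bigr h); last by move=> x _; rewrite mmapX mmap1U.
  set l := if i == 0%N then 0%N else j.
  have hl : (l < r.+1)%N by rewrite /l; case: eqP; lia.
  rewrite (big_setID (face_bar l)) /= (setIidPr (face_bar_sub_Cbar hij)).
  have := prod_face_bar (fun x => z x) s (Ordinal hl); rewrite /= => ->.
  by rewrite mulrC -mulrA LG.
(* All monomials of [g] lie in the box and involve only path variables, so [L] vanishes on each of
   them except [mo]. *)
move: hk; rewrite /mmap.
have Lsum (I : eqType) (rr : seq I) (F : I -> A) : L (\sum_(i <- rr) F i) = \sum_(i <- rr) L (F i).
  by elim: rr => [|i rr IH]; rewrite ?big_nil // !big_cons LD IH.
rewrite Lsum (bigD1_seq mo) ?msupp_uniq //= LZ mmap1_h // (LE (fun l => mo (qi (inord l)))); last first.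
  by move=> l hl; have := box_lt _ hmo (inord l); rewrite inordK.
rewrite (introT forallP) ?mulr1; last by move=> l.
rewrite big_seq_cond big1 ?addr0; last first.
  move=> mo' /andP[hmo' nmo]; rewrite LZ mmap1_h // (LE (fun l => mo' (qi (inord l)))); last first.
    by move=> l hl; have := box_lt _ hmo' (inord l); rewrite inordK.
  case: forallP => [H|_]; last by rewrite mulr0.
  case/eqP: nmo; apply/mnmP => x; have [hx|hx] := leqP x r; last by rewrite !mo_hi.
  by have /eqP := H (inord x); rewrite inord_val qi_inord.
by move: hmo; rewrite mcoeff_msupp => /eqP.
Qed.
End Algebra.
End Ordering.

Lemma ordering_exists : exists e : 'I_#|S| -> T,
  [/\ injective e, forall i, e i \in S & forall i : 'I_#|S|, (i <= r)%N -> e i = q i].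
Proof.
pose qs := [seq q l | l <- iota 0 r.+1]; pose es := qs ++ enum nonq.
have qs_uniq : uniq qs.
  rewrite map_inj_in_uniq ?iota_uniq // => l l'; rewrite !mem_iota !add0n => h h'.
  by apply: q_inj; rewrite -ltnS.
have es_uniq : uniq es.
  rewrite cat_uniq qs_uniq enum_uniq andbT; apply/hasPn => x; rewrite mem_enum inE => /andP[_ nx].
  apply: contra nx => /mapP[l]; rewrite mem_iota add0n ltnS => hl ->; by rewrite sg_q.
have es_size : size es = #|S|.
  by rewrite size_cat size_map size_iota -cardE addnC -nonq_card.
exists (fun i => nth (q 0) es i); split.
- by move=> i i' /eqP; rewrite nth_uniq ?es_size // => /eqP /val_inj.
- move=> i; have : nth (q 0) es i \in es by rewrite mem_nth ?es_size.
  rewrite mem_cat => /orP[/mapP[l]|]; last by rewrite mem_enum inE => /andP[].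
  by rewrite mem_iota add0n ltnS => hl ->; apply: q_in.
move=> i hi; rewrite nth_cat size_map size_iota ltnS hi (nth_map 0%N) ?size_iota //.
by rewrite nth_iota.
Qed.

Lemma dual_path_NBC_basis (k : fieldType) :
  (exists x, [/\ x \in S, sg x = 0%N & x != q 0]) -> has_NBC_basis k N.
Proof.
move=> a0; have [e [e_inj e_in e_q]] := ordering_exists.
have r_lt_m : (r < #|S|)%N by rewrite nonq_card; lia.
have [astar [adm aE]] := admissible_exists k.
exists e; split=> //; split=> //; split; first exact: Bset_basis.
exists astar; split=> //; split.
  by move=> p; have [g hg Ig] := L_spanning e_inj e_in r_lt_m e_q a0 aE p; exists g.
exact: L_independent.
Qed.

End DualGraph.

(** * Chains of cycles *)

Lemma circuits_uniform (T : finType) (A : {set T}) (n : nat) :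
  #|A| = n -> (0 < n)%N -> circuits (uniform (n - 1) A) = [set A].
Proof.
move=> cA n0; rewrite /uniform /matroid_of_bases /=.
have depE (X : {set T}) : (X \subset A) &&
    ~~ [exists B in [set Y : {set T} | (Y \subset A) && (#|Y| == n - 1)%N], X \subset B] = (X == A).
  apply/idP/eqP => [/andP[XA /existsP nB]|->].
    apply/eqP; rewrite eqEsubset XA; apply/negPn/negP => /subsetPn[x xA xX].
    case: nB; exists (A :\ x); rewrite inE subsetDl /=.
    have := cardsD1 x A; rewrite xA cA => cAx; rewrite subsetD1 XA xX.
    by rewrite !andbT; apply/eqP; lia.
  apply/andP; split=> //; apply/existsP => -[B /andP[]]; rewrite inE => /andP[BA /eqP cB] AB.
  by have := subset_leq_card AB; rewrite cA cB; lia.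
apply/setP => C; rewrite !inE depE; apply: andb_idr => /eqP ->.
by apply/forallP => C'; apply/implyP; rewrite depE => /proper_neq.
Qed.

Section CycleChain.
Variables (T : finType) (r : nat) (E : nat -> {set T}) (n : nat -> nat) (p : nat -> T).
Hypothesis cardE : forall i, (i <= r)%N -> #|E i| = n i /\ (2 <= n i)%N.
Hypothesis capE : forall i, (i < r)%N -> E i :&: E i.+1 = [set p i.+1].
Hypothesis farE : forall i j, (i <= r)%N -> (j <= r)%N ->
  (i.+1 < j)%N || (j.+1 < i)%N -> E i :&: E j = set0.
Hypothesis p_inj : forall i j, (1 <= i <= r)%N -> (1 <= j <= r)%N -> i != j -> p i != p j.

Local Notation M := (fun i => uniform (n i - 1) (E i)).
Local Notation N := (parallel_iter M p r).

Definition first_face (x : T) : nat := find (fun i => x \in E i) (iota 0 r.+1).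

(** There is no next face to share an edge with, so any element of [E r] other than [p r] serves as
    [q r]. The default is never reached, as [E r] has at least two elements. *)
Definition last_edge : T := odflt (p r) [pick x in E r :\ p r].

Definition face_edge (l : nat) : T := if (l < r)%N then p l.+1 else last_edge.

Local Notation sg := first_face.
Local Notation q := face_edge.

Lemma ground_iter j : ground (parallel_iter M p j) = \bigcup_(i < j.+1) E i.
Proof.
elim: j => [|j IH] /=; first by rewrite big_ord1.
by rewrite IH [RHS]big_ord_recr.
Qed.

Lemma mem_groundP x : reflect (exists2 i, (i <= r)%N & x \in E i) (x \in ground N).
Proof.
rewrite ground_iter; apply: (iffP bigcupP) => [[i _ xE]|[i hi xE]].
  by exists i; rewrite // leq_ord.
by exists (inord i); rewrite ?inordK.
Qed.

Lemma first_face_min x i : (i < sg x)%N -> x \notin E i.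
Proof.
move=> hi; have lt_i : (i < r.+1)%N.
  by apply: leq_trans hi _; rewrite -[r.+1 in X in (_ <= X)%N](size_iota 0) find_size.
by have := before_find 0%N hi; rewrite nth_iota // add0n => ->.
Qed.

Lemma first_face_mem x : x \in ground N -> (sg x <= r)%N /\ x \in E (sg x).
Proof.
case/mem_groundP => i hi xE.
have hx : has (fun i => x \in E i) (iota 0 r.+1).
  by apply/hasP; exists i => //; rewrite mem_iota.
have lt_s : (sg x < r.+1)%N by move: (hx); rewrite has_find size_iota.
by have := nth_find 0%N hx; rewrite nth_iota.
Qed.

Lemma shared_edge x i j : (i < j <= r)%N -> x \in E i -> x \in E j ->
  j = i.+1 /\ x = p j.
Proof.
move=> /andP[ij jr] xi xj.
have ej : j = i.+1.
  apply/eqP; rewrite eqn_leq ij andbT leqNgt; apply/negP => hij.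
  have : x \in E i :&: E j by rewrite inE xi xj.
  by rewrite farE ?inE ?hij //; lia.
split=> //; have : x \in E i :&: E i.+1 by rewrite inE xi -ej.
by rewrite capE ?inE -?ej // => /eqP.
Qed.

Lemma p_mem i : (i < r)%N -> p i.+1 \in E i /\ p i.+1 \in E i.+1.
Proof.
by move=> hi; apply/andP; rewrite -in_setI capE // set11.
Qed.

Lemma last_edge_mem : last_edge \in E r /\ last_edge != p r.
Proof.
have [cE n2] := cardE (leqnn r).
rewrite /last_edge; case: pickP => [x|no]; first by rewrite !inE => /andP[].
by have := cardsD1 (p r) (E r); rewrite (eq_card0 no) cE; case: (p r \in _); lia.
Qed.

Lemma face_edge_mem l : (l <= r)%N -> q l \in E l.
Proof.
rewrite /face_edge; case: ltnP => [hl _|hl lr]; first by case: (p_mem hl).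
by have -> : l = r by [lia]; case: last_edge_mem.
Qed.

Lemma face_edge_ground l : (l <= r)%N -> q l \in ground N.
Proof. by move=> hl; apply/mem_groundP; exists l => //; apply: face_edge_mem. Qed.

Lemma first_face_le x : x \in ground N -> (sg x <= r)%N.
Proof. by case/first_face_mem. Qed.

(** If [q l] lay on an earlier face it would equal [p l], against the distinctness of the [p i] or
    the choice of [last_edge]. *)
Lemma first_face_edge l : (l <= r)%N -> sg (q l) = l.
Proof.
move=> hl; have ql := face_edge_mem hl.
have [_ qs] := first_face_mem (face_edge_ground hl).
have le_sl : (sg (q l) <= l)%N.
  by rewrite leqNgt; apply/negP => /first_face_min; rewrite ql.
apply/eqP; rewrite eqn_leq le_sl leqNgt; apply/negP => lt_sl.
have [|el eq_p] := shared_edge (x := q l) (i := sg (q l)) (j := l) _ qs ql; first by rewrite lt_sl.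
move: eq_p; rewrite /face_edge; case: ltnP => hlr /eqP; apply/negP.
  by apply: p_inj; lia.
by have -> : l = r by [lia]; case: last_edge_mem.
Qed.

Local Notation cut := (cut N r sg q).

(** The edges at the dual vertex [i] are the elements with first face [i] and, for positive [i], the
    element [p i] shared with the previous face. *)
Lemma cut_face i : (i <= r)%N -> cut i i = E i.
Proof.
move=> hi; apply/setP => x; have [xS|xS] := boolP (x \in ground N); last first.
  rewrite inE (negbTE xS); apply/esym/negbTE; apply: contra xS => xE.
  by apply/mem_groundP; exists i.
have [sr xs] := first_face_mem xS.
rewrite mem_cut ?leqnn //; apply/idP/idP => [|xE].
  case: eqP => [ex|_]; last by rewrite -eqn_leq => /eqP ->.
  move=> /orP[/eqP <- //|/eqP si]; rewrite ex /face_edge si ifT; last by lia.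
  by rewrite -si; case: (p_mem (i := sg x)) => //; lia.
have le_si : (sg x <= i)%N by rewrite leqNgt; apply/negP => /first_face_min; rewrite xE.
have [->|ne_si] := eqVneq (sg x) i; first by rewrite leqnn; case: ifP.
have lt_si : (sg x < i)%N by lia.
have [|ei ex] := shared_edge (x := x) (i := sg x) (j := i) _ xs xE; first by rewrite lt_si.
have eq_q : x == q (sg x) by apply/eqP; rewrite {1}ex /face_edge ifT -?ei //; lia.
by rewrite eq_q -ei eqxx orbT.
Qed.

(** The two cuts share only [q j], so the left side is their symmetric difference, the cut of the
    union of the two intervals. *)
Lemma cut_step i j : (i <= j < r)%N ->
  (cut i j :|: cut j.+1 j.+1) :\ q j = cut i j.+1.
Proof.
move=> hij; apply/setP => x; have [xS|xS] := boolP (x \in ground N); last first.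
  by rewrite !inE (negbTE xS) andbF.
have := first_face_le xS => sr; rewrite in_setD1 in_setU !mem_cut //; try lia.
have [ex|nx] := eqVneq x (q (sg x)); last first.
  have -> : x != q j.
    by apply: contra nx => /eqP ->; rewrite first_face_edge //; lia.
  by lia.
have -> : (x == q j) = (sg x == j).
  apply/eqP/eqP => [->|<- //]; rewrite first_face_edge //; lia.
lia.
Qed.

(** Among the old cuts, those containing the connecting element [p j.+1 = q j] are the ones ending
    at [j]; joining them with the new cycle gives the cuts ending at [j.+1]. *)
Lemma circuits_iter j C : (j <= r)%N ->
  reflect (exists i i', (i <= i' <= j)%N /\ C = cut i i')
          (C \in circuits (parallel_iter M p j)).
Proof.
have circM i : (i <= r)%N -> circuits (uniform (n i - 1) (E i)) = [set cut i i].
  by move=> hi; have [cE n2] := cardE hi; rewrite cut_face // circuits_uniform //; lia.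
elim: j C => [|j IH] C hj.
  rewrite circM // inE; apply: (iffP eqP) => [->|[i [i' [h ->]]]]; first by exists 0%N, 0%N.
  by have [-> ->] : i = 0%N /\ i' = 0%N by lia.
have pq : p j.+1 = q j by rewrite /face_edge hj.
have cut_le i i' : (i <= i' <= j)%N -> (q j \in cut i i') = (i' == j).
  by move=> h; rewrite (q_cut face_edge_ground first_face_edge); lia.
have -> : circuits (parallel_iter M p j.+1) =
    circuits (parallel_iter M p j) :|: [set cut j.+1 j.+1] :|:
    [set (C1 :|: C2) :\ p j.+1 | C1 in circuits (parallel_iter M p j),
       C2 in [set cut j.+1 j.+1] & (p j.+1 \in C1) && (p j.+1 \in C2)].
  by rewrite -circM.
apply: (iffP setUP).
  case=> [/setUP[/(IH _ (ltnW hj))[i [i' [h ->]]]|/set1P ->]|].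
  - by exists i, i'; split=> //; lia.
  - by exists j.+1, j.+1; rewrite leqnn.
  case/imset2P => C1 C2 /(IH _ (ltnW hj))[i [i' [h ->]]].
  rewrite pq inE => /andP[/set1P -> /andP[+ _]] ->.
  rewrite cut_le // => /eqP ei; rewrite ei cut_step; last by lia.
  by exists i, j.+1; split=> //; lia.
move=> [i [i' [h ->]]]; have [h1|h1] := leqP i' j.
  left; apply/setUP; left; apply/(IH _ (ltnW hj)); exists i, i'; split=> //; lia.
have -> : i' = j.+1 by lia.
have [->|ni] := eqVneq i j.+1; first by left; apply/setUP; right; rewrite set11.
right; rewrite -cut_step; last by lia.
have qj : q j \in cut j.+1 j.+1.
  by rewrite (q_cut face_edge_ground first_face_edge); lia.
rewrite pq; apply/imset2P; exists (cut i j) (cut j.+1 j.+1) => //.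
  by apply/(IH _ (ltnW hj)); exists i, j; split=> //; lia.
by rewrite inE set11 cut_le ?eqxx //; lia.
Qed.

Lemma cycle_chain_NBC_basis (k : fieldType) : has_NBC_basis k N.
Proof.
apply: (@dual_path_NBC_basis T N r sg q).
- exact: first_face_le.
- exact: face_edge_ground.
- exact: first_face_edge.
- by move=> C; apply: circuits_iter.
have [cE n2] := cardE (leq0n r).
(* As [E 0] has at least two elements, face 0 carries a basis element besides [q 0]. *)
have /card_gt0P[x] : (0 < #|E 0 :\ q 0|)%N.
  by have := cardsD1 (q 0) (E 0); rewrite cE; case: (_ \in _); lia.
rewrite !inE => /andP[nx xE]; exists x; split=> //; first by apply/mem_groundP; exists 0%N.
by apply/eqP; rewrite -leqn0 leqNgt; apply/negP => /first_face_min; rewrite xE.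
Qed.

End CycleChain.

(* 0-based: M_i = face_bar(n_i - 1, n_i) on E i for i < t; p i for 1 <= i < t *)
Theorem theorem5p8 (k : fieldType) (T : finType) (t : nat)
    (E : nat -> {set T}) (n : nat -> nat) (p : nat -> T) :
  (0 < t)%N ->
  (forall i, (i < t)%N -> #|E i| = n i /\ (2 <= n i)%N) ->
  (forall i, (i.+1 < t)%N -> E i :&: E i.+1 = [set p i.+1]) ->
  (forall i j, (i < t)%N -> (j < t)%N -> ((i.+1 < j)%N || (j.+1 < i)%N) ->
     E i :&: E j = set0) ->
  (forall i j, (1 <= i < t)%N -> (1 <= j < t)%N -> i != j -> p i != p j) ->
  has_NBC_basis k
    (parallel_iter (fun i => uniform (n i - 1) (E i)) p t.-1).
Proof.
case: t => [//|r] _ cardE capE farE p_inj; exact: cycle_chain_NBC_basis.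
Qed.
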